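(* We have $$\max_{t \in K}|Q(t)| \leq T_{2n}(\sec(s/4)) = \frac12\left((\sec(s/4)+\tan(s/4))^{2n} + (\sec(s/4)-\tan(s/4))^{2n}\right)$$ for every even $Q \in \mathcal{T}_n^c(s)$ and $s \in (0,2\pi)$. Equality holds if and only if $$\{t \in K : |Q(t)| \leq 1\} = [s/2,\, 2\pi - s/2]$$ and $Q \in \mathcal{T}_n(s)$ is of the form $$Q(t) = T_{2n}\left(\frac{\cos(t/2)}{\cos(s/4)}\right).$$
   Context: $n$ is a positive integer, $K := \mathbb{R} \pmod{2\pi}$, and $m$ denotes Lebesgue measure (for subsets of $K$, measured on one period). $\mathcal{T}_n$ and $\mathcal{T}_n^c$ are the sets of all trigonometric polynomials of degree at most $n$ with real, respectively complex, coefficients. For $s \in (0,2\pi)$, $\mathcal{T}_n(s) := \{Q \in \mathcal{T}_n : m(\{t \in K : |Q(t)| \leq 1\}) \geq 2\pi - s\}$ and $\mathcal{T}_n^c(s) := \{Q \in \mathcal{T}_n^c : m(\{t \in K : |Q(t)| \leq 1\}) \geq 2\pi - s\}$. $Q$ is even if $Q(-t)=Q(t)$ for all $t$. $T_{2n}$ is the Chebyshev polynomial of degree $2n$, defined by $T_{2n}(\cos t) = \cos(2nt)$.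
   Formalization: The ''only if'' in the equality case fails as printed (−Q and Q(t+π) are also extremal), so equality is characterized by the stated conditions holding for cQ(t+d), for some complex c with |c| = 1 and some d in {0, π}. *)

(* Defs.v *)
From HB Require Import structures.
From mathcomp Require Import all_boot all_order all_algebra.
From mathcomp Require Import all_classical all_reals all_analysis.
From mathcomp Require Import complex ring.

Set Implicit Arguments.
Unset Strict Implicit.
Unset Printing Implicit Defensive.

Import Order.TTheory GRing.Theory Num.Theory.
Import numFieldNormedType.Exports.

Local Open Scope classical_set_scope.
Local Open Scope complex_scope.
Local Open Scope ring_scope.

(* Functions on K = R / 2 pi Z are represented by functions on R; the
   trigonometric sums below are 2 pi-periodic by construction. *)

Definition trig_sum (R : realType) (n : nat) (a b : nat -> R[i]) (t : R) : R[i] :=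
  a 0%N + \sum_(1 <= k < n.+1)
            (a k * (cos (k%:R * t))%:C + b k * (sin (k%:R * t))%:C).

Definition trig_polyC (R : realType) (n : nat) (Q : R -> R[i]) : Prop :=
  exists a b : nat -> R[i], Q =1 trig_sum n a b.

Definition trig_polyR (R : realType) (n : nat) (Q : R -> R[i]) : Prop :=
  exists a b : nat -> R, Q =1 trig_sum n (fun k => (a k)%:C) (fun k => (b k)%:C).

(* The subset {t in K : |Q t| <= 1} of K, each point of K being represented
   in the period [0, 2 pi). *)
Definition sublevel (R : realType) (Q : R -> R[i]) : set R :=
  [set t | 0 <= t < 2 * pi /\ ComplexField.Normc.normc (Q t) <= 1].

Definition trig_polyC_s (R : realType) (n : nat) (s : R) (Q : R -> R[i]) : Prop :=
  trig_polyC n Q /\ ((2 * pi - s)%:E <= lebesgue_measure (sublevel Q))%E.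

Definition trig_polyR_s (R : realType) (n : nat) (s : R) (Q : R -> R[i]) : Prop :=
  trig_polyR n Q /\ ((2 * pi - s)%:E <= lebesgue_measure (sublevel Q))%E.

Definition even_fun_C (R : realType) (Q : R -> R[i]) : Prop :=
  forall t, Q (- t) = Q t.

(* M = max |Q|, the maximum being attained. *)
Definition is_max_norm (R : realType) (Q : R -> R[i]) (M : R) : Prop :=
  (exists t, ComplexField.Normc.normc (Q t) = M) /\
  (forall t, ComplexField.Normc.normc (Q t) <= M).

Definition sec (R : realType) (x : R) : R := (cos x)^-1.

Definition is_chebyshev (R : realType) (k : nat) (T : {poly R}) : Prop :=
  size T = k.+1 /\ forall t : R, T.[cos t] = cos (k%:R * t).

Lemma chebyshev_exists (R : realType) (k : nat) :
  exists T : {poly R}, is_chebyshev k T.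
Proof.
suff [T [U [H _]]] : exists T U : {poly R},
    is_chebyshev k T /\ is_chebyshev k.+1 U by exists T.
elim: k => [|k [T [U [[sT hT] [sU hU]]]]].
  exists 1, 'X; split; split.
  - by rewrite size_poly1.
  - by move=> t; rewrite hornerC mul0r cos0.
  - by rewrite size_polyX.
  - by move=> t; rewrite hornerX mul1r.
exists U, (2%:R *: ('X * U) - T); split; split=> //.
  have U0 : U != 0 by rewrite -size_poly_eq0 sU.
  have sXU : size (2%:R *: ('X * U)) = k.+3.
    by rewrite size_scale ?pnatr_eq0// mulrC size_mulX// sU.
  by rewrite size_polyDl ?sXU// size_polyN sT.
move=> t; rewrite hornerD hornerN hornerZ hornerM hornerX hU hT.
have -> : k.+2%:R * t = k.+1%:R * t + t by rewrite -[k.+2]addn1 natrD mulrDl mul1r.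
have -> : k%:R * t = k.+1%:R * t - t by rewrite -[k.+1]addn1 natrD mulrDl mul1r addrK.
rewrite (cosB (k.+1%:R * t) t) (cosD (k.+1%:R * t) t).
by ring.
Qed.

(* Main.v *)
Require Import Defs.
From mathcomp Require Import all_boot all_order all_algebra.
From mathcomp Require Import all_classical all_reals all_analysis.
From mathcomp Require Import complex.
From mathcomp Require Import ring lra zify.
Import Order.TTheory GRing.Theory Num.Theory.
Import numFieldNormedType.Exports.
Local Open Scope classical_set_scope.
Local Open Scope complex_scope.
Local Open Scope ring_scope.

Set Implicit Arguments.
Unset Strict Implicit.
Unset Printing Implicit Defensive.

(* Multiplying Q by a unimodular constant and translating, one may bound the value at 0
   of the real part of Q.  In the variable x = t / 2 a real trigonometric polynomial of
   degree n is a form of degree N = 2n in (cos x, sin x), that is sin^N x q(cot x), and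
   its value at 0 is the leading coefficient of q.

   Among the forms with a given value M > 1 at 0, let P maximize the measure of the level
   set E = {0 < x < pi, |P| <= 1} (compactness).  If P had a critical point x1 with
   |P(x1)| > 1, then P' / (cot x - cot x1) would again be a form, with value 0 at 0, and
   subtracting a small multiple of it from P would move E by a map that expands it: this
   contradicts maximality.  So E is an interval.  Lagrange interpolation of the leading
   coefficient at the points where the Chebyshev form of that interval alternates gives
   M <= T_N(cos w / cos(sigma / 2)), where pi - sigma is the length of E and w the
   displacement of its centre; this is at most T_N(sec(sigma / 2)).

   In case of equality the given form is itself a maximizer, so the real part of Q is the
   Chebyshev form.  The set {|Q| <= 1} is then all of the interval where the real part is
   in [-1, 1]; the imaginary part vanishes at the N + 1 points where the real part is
   1 or -1, hence identically.  Evenness forces the peak to lie at 0 or pi. *)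

(** * Lebesgue measure of expanded sets *)

Section expanding.
Context {R : realType}.
Let mu := (@lebesgue_measure R).
Local Open Scope ereal_scope.

(** A nonempty [A] lies in the segment of length [d] that starts at its infimum, and the outer
    measure is monotone on arbitrary sets. *)
Lemma lebesgue_measure_diam (A : set R) (d : R) : (0 <= d)%R ->
  (forall x y, A x -> A y -> (x - y <= d)%R) -> mu A <= d%:E.
Proof.
move=> d0 Ad; have [->|/set0P[x0 Ax0]] := eqVneq A set0.
  by rewrite /mu measure0 lee_fin.
have lbA : has_lbound A by exists (x0 - d)%R => y Ay; have := Ad _ _ Ax0 Ay; lra.
have sub : A `<=` `[inf A, (inf A + d)%R]%classic.
  move=> x Ax /=; rewrite in_itv/= ge_inf//=.
  rewrite -lerBlDr; apply: lb_le_inf; first by exists x0.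
  by move=> y Ay; have := Ad _ _ Ax Ay; lra.
apply: (@le_trans _ _ (mu `[inf A, (inf A + d)%R]%classic)).
  exact: le_outer_measure.
rewrite /mu lebesgue_measure_itv/=.
by case: ifPn => _; rewrite -?EFinB lee_fin; lra.
Qed.

(** A cover of [B] by open intervals of total length close to [mu B] pulls back along [f] to a cover
    of [A] by pieces whose diameters are at most [K] times those lengths. *)
Lemma lebesgue_measure_expanding (A B : set R) (f : R -> R) (K : R) :
  (0 < K)%R -> (forall x, A x -> B (f x)) ->
  (forall x y, A x -> A y -> `|x - y| <= K * `|f x - f y|)%R ->
  mu A <= K%:E * mu B.
Proof.
move=> K0 AB fK.
have [Boo|Boo] := eqVneq (mu B) +oo; first by rewrite Boo gt0_muley ?leey.
have Bfin : mu B \is a fin_num by rewrite ge0_fin_numE ?outer_measure_ge0// ltey.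
apply/lee_addgt0Pr => /= e e0.
(* The slack [e / K] becomes [e] after multiplication by [K]. *)
have [F BF Fe] : exists2 F, open_itv_cover B F &
    \sum_(0 <= k <oo) wlength idfun (F k) <= mu B + (e / K)%:E.
  have eK0 : (0 < e / K)%R by rewrite divr_gt0.
  have : mu B = (wlength idfun)^*%mu B by [].
  rewrite measurable_realfun.outer_measure_open_itv_cover => muB.
  move: Bfin; rewrite muB => /lb_ereal_inf_adherent-/(_ _ eK0)[_/= [F]] BF <- Fe.
  by exists F => //; exact/ltW.
have AF : A `<=` \bigcup_k (A `&` f @^-1` F k).
  move=> x Ax; have [_ /(_ _ (AB _ Ax))[k _ Fkx]] := BF.
  by exists k.
rewrite (le_trans (le_outer_measure mu _ _ AF))//.
rewrite (le_trans (outer_measure_sigma_subadditive mu _))//.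
have l0 k : 0 <= wlength idfun (F k) by exact: wlength_ge0.
rewrite (@le_trans _ _ (\sum_(0 <= k <oo) (K%:E * wlength idfun (F k))))//; last first.
  rewrite nneseriesZl// (@le_trans _ _ (K%:E * (mu B + (e / K)%:E)))//.
    by rewrite lee_pmul2l// lte_fin.
  rewrite muleDr ?fin_num_adde_defl// -EFinM.
  by rewrite (_ : (K * (e / K))%R = e)//; field; rewrite gt_eqF.
apply: lee_nneseries => [k _ _|k _]; first exact: measure_ge0.
have [/(_ k)[[a b] /= Fk] _] := BF; rewrite Fk.
(* An interval of the cover may have [b < a]; it is then empty, of length 0, hence the maximum. *)
apply: (@le_trans _ _ (K * Num.max 0 (b - a))%:E).
  apply: lebesgue_measure_diam; first by apply: mulr_ge0; [exact: ltW|rewrite le_max lexx].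
  move=> x y [Ax +] [Ay +]; rewrite /= !in_itv/= => /andP[? ?] /andP[? ?].
  rewrite (le_trans (ler_norm _))// (le_trans (fK _ _ Ax Ay))// ler_pM2l//.
  rewrite le_max; apply/orP; right; rewrite ler_norml; apply/andP; split; lra.
rewrite EFinM lee_pmul2l// ?lte_fin//.
have -> : wlength idfun (`]a, b[%classic : set R) = if (a < b)%R then (b - a)%:E else 0.
  have := wlength_itv (idfun : R -> R) `]a, b[; rewrite /= lte_fin => ->.
  by case: ifP => // _; rewrite EFinB.
by case: ltP => h; rewrite lee_fin ge_max; apply/andP; split; lra.
Qed.

End expanding.

(** * Homogeneous forms in sine and cosine *)

Section forms.
Context {R : realType}.
Implicit Types (N : nat) (q : {poly R}) (x : R).

Definition cot x : R := cos x / sin x.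

(* [form N q x] is [sin x ^+ N * q.[cot x]], extended by continuity to
   [sin x = 0]: its value at [0] is the coefficient of degree [N] of [q]. *)
Definition form N q x : R :=
  \sum_(k < N.+1) q`_k * (cos x ^+ k * sin x ^+ (N - k)).

Lemma form_cot N q x : 0 < x < pi -> (size q <= N.+1)%N ->
  form N q x = sin x ^+ N * q.[cot x].
Proof.
move=> /sin_gt0_pi s0 sq; rewrite (horner_coef_wide _ sq) mulr_sumr.
apply: eq_bigr => k _; rewrite expr_div_n.
have kN : (k <= N)%N by rewrite -ltnS.
have -> : sin x ^+ N = sin x ^+ (N - k) * sin x ^+ k by rewrite -exprD (subnK kN).
by field; rewrite gt_eqF// exprn_gt0.
Qed.

Lemma formD N p q x : form N (p + q) x = form N p x + form N q x.
Proof.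
by rewrite -big_split; apply: eq_bigr => k _; rewrite /= coefD mulrDl.
Qed.

Lemma formZ N (c : R) q x : form N (c *: q) x = c * form N q x.
Proof. by rewrite mulr_sumr; apply: eq_bigr => k _; rewrite coefZ -mulrA. Qed.

Lemma formB N p q x : form N (p - q) x = form N p x - form N q x.
Proof. by rewrite formD -scaleN1r formZ mulN1r. Qed.

Lemma form0 N q : form N q 0 = q`_N.
Proof.
rewrite /form big_ord_recr/= subnn sin0 cos0 expr1n !mulr1 big1 ?add0r// => k _.
by rewrite expr0n subn_eq0 leqNgt ltn_ord !mulr0.
Qed.

Lemma norm_form_pi N q : `|form N q pi| = `|q`_N|.
Proof.
rewrite /form big_ord_recr/= subnn sinpi cospi mulr1 big1 ?add0r => [|k _].
  by rewrite normrM normrX normrN1 expr1n mulr1.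
by rewrite expr0n subn_eq0 leqNgt ltn_ord !mulr0.
Qed.

Lemma continuous_form N q : continuous (form N q).
Proof.
move=> x; rewrite (_ : form N q = \sum_(k < N.+1)
    (fun y => q`_k * (cos y ^+ k * sin y ^+ (N - k)))); last first.
  by apply/funext => y; rewrite fct_sumE.
apply: big_ind => [|f g cf cg|k _]; [exact: cvg_cst|exact: continuousD|].
have cX (f : R -> R) n : {for x, continuous f} ->
    f y ^+ n @[y --> x] --> f x ^+ n.
  by move=> cf; exact: (continuous_comp cf (@exprn_continuous _ _ _)).
exact: (cvgM (cvg_cst _) (cvgM (cX _ k (@continuous_cos _ _))
  (cX _ (N - k)%N (@continuous_sin _ _)))).
Qed.

Lemma ler_form N q x : `|form N q x| <= \sum_(k < N.+1) `|q`_k|.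
Proof.
apply: le_trans (ler_norm_sum _ _ _) _; apply: ler_sum => k _.
rewrite !normrM !normrX ler_piMr// mulr_ile1// ?exprn_ge0// exprn_ile1//.
  exact: cos_max.
exact: sin_max.
Qed.

(* [(sin ^ N q(cot))' = sin ^ N (N cot q(cot) - (1 + cot ^ 2) q'(cot))] *)
Definition dform N q : {poly R} := N%:R *: ('X * q) - (1 + 'X^2) * q^`().

Lemma size_dform N q : (size q <= N.+1)%N -> (size (dform N q) <= N.+1)%N.
Proof.
move=> sq; apply/leq_sizeP => j Nj.
rewrite coefB coefZ coefXM mulrDl mul1r coefD coefXnM !coef_deriv.
have q0 i : (N < i)%N -> q`_i = 0.
  by move=> Ni; rewrite nth_default// (leq_trans sq).
case: j Nj => // j Nj; rewrite /= (q0 j.+2) ?mul0rn ?add0r; last by lia.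
case: j Nj => [|j] Nj.
  by case: N {sq} q0 Nj => // q0 _; rewrite mul0r subr0.
rewrite subn2/= mulr_natl.
have [->|/eqP jN] := eqVneq N j.+1; first by rewrite subrr.
by rewrite q0 ?mul0rn ?subrr//; lia.
Qed.

Lemma is_derive_cot x : sin x != 0 -> is_derive x 1 cot (- (sin x)^-2).
Proof.
move=> sx.
have dV := is_deriveV sx (is_derive_sin x).
apply: is_derive_eq (is_deriveM (is_derive_cos x) dV) _.
rewrite /GRing.scale/=.
have e : cos x ^+ 2 = 1 - sin x ^+ 2 by rewrite -(cos2Dsin2 x) addrK.
rewrite (_ : _ + _ = - (cos x ^+ 2 + sin x ^+ 2) * (sin x) ^- 2); first by rewrite cos2Dsin2 mulN1r.
by field.
Qed.

Lemma cot2 x : sin x != 0 -> 1 + cot x ^+ 2 = (sin x) ^- 2.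
Proof.
move=> sx; rewrite /cot expr_div_n.
rewrite -[X in X + _](@divff _ (sin x ^+ 2)) ?expf_neq0//.
by rewrite -mulrDl addrC cos2Dsin2 mul1r.
Qed.

Lemma is_derive_form N q x : 0 < x < pi -> (size q <= N.+1)%N ->
  is_derive x 1 (form N q) (form N (dform N q) x).
Proof.
move=> x0 sq; have s0 := sin_gt0_pi x0.
apply: (@near_eq_is_derive _ _ _ (fun y => sin y ^+ N * q.[cot y])).
  have : x \in `]0, pi[%R by rewrite in_itv.
  move=> /near_in_itvoo; apply: filterS => y; rewrite in_itv/= => y0.
  by rewrite form_cot.
have dc := is_derive_cot (lt0r_neq0 s0).
have dq := is_derive1_comp (is_derive_poly q (cot x)) dc.
have ds := is_deriveX N (is_derive_sin x).
have -> : (fun y => sin y ^+ N * q.[cot y]) = (@sin R) ^+ N * (horner q \o cot).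
  by apply/funext => y; rewrite !fctE.
apply: is_derive_eq (is_deriveM ds dq) _.
rewrite fctE form_cot ?size_dform// /dform !hornerE/= /GRing.scale/=.
rewrite cot2 ?gt_eqF//; case: N {sq ds} => [|N]; first by rewrite expr0; ring.
by rewrite exprS /=; field; rewrite gt_eqF.
Qed.

Lemma MVT_form N q x y : (size q <= N.+1)%N -> 0 < x < pi -> 0 < y < pi ->
  exists2 c, 0 < c < pi /\ `|c - x| <= `|y - x| &
    form N q y - form N q x = form N (dform N q) c * (y - x).
Proof.
move=> sq x0 y0.
have H a b : 0 < a -> b < pi -> a <= b -> exists2 c, c \in `[a, b]%R &
    form N q b - form N q a = form N (dform N q) c * (b - a).
  move=> a0 bpi ab; apply: MVT_segment => // [z|].
    rewrite in_itv/= => /andP[az zb]; apply: is_derive_form => //.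
    by rewrite (lt_trans a0 az) (lt_trans zb bpi).
  by apply: continuous_subspaceT => z; exact: continuous_form.
have [xy|/ltW yx] := leP x y.
  have [||c +] := H x y _ _ xy; [by lra|by lra|].
  rewrite in_itv/= => cxy e; exists c => //; split; first lra.
  by rewrite !ger0_norm; lra.
have [||c +] := H y x _ _ yx; [by lra|by lra|].
rewrite in_itv/= => cxy e; exists c; last by rewrite -opprB e; ring.
split; first lra.
by rewrite !ler0_norm; lra.
Qed.

Lemma lipschitz_form N q : (size q <= N.+1)%N -> exists2 C : R, 0 <= C &
  forall x y, 0 < x < pi -> 0 < y < pi ->
    `|form N q y - form N q x| <= C * `|y - x|.
Proof.
move=> sq; exists (\sum_(k < N.+1) `|(dform N q)`_k|); first exact: sumr_ge0.
move=> x y x0 y0; have [c _ ->] := MVT_form sq x0 y0.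
by rewrite normrM ler_wpM2r// ler_form.
Qed.

Lemma taylor_form N q : (size q <= N.+1)%N -> exists2 C : R, 0 <= C &
  forall x y, 0 < x < pi -> 0 < y < pi ->
    `|form N q y - form N q x - form N (dform N q) x * (y - x)|
      <= C * (y - x) ^+ 2.
Proof.
move=> sq; have [C C0 HC] := lipschitz_form (size_dform sq).
exists C => // x y x0 y0; have [c [c0 cx] ->] := MVT_form sq x0 y0.
rewrite -mulrBl normrM -real_normK ?num_real// expr2 mulrA ler_wpM2r//.
by rewrite (le_trans (HC _ _ x0 c0))// ler_wpM2l.
Qed.


End forms.

(** * Level sets of forms *)

Lemma finite_root (F : idomainType) (p : {poly F}) : p != 0 -> finite_set [set x | root p x].
Proof.
have [n] := ubnP (size p); elim: n p => // n IH p sp p0.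
have [[a pa]|no] := pselect (exists a, root p a); last first.
  by rewrite (_ : mkset _ = set0)//; apply/seteqP; split => // x px; case: no; exists x.
move/factor_theorem: pa => [r pr].
have r0 : r != 0 by apply: contraNneq p0 => r0; rewrite pr r0 mul0r.
have sr : (size r < n)%N.
  by move: sp; rewrite pr size_Mmonic ?monicXsubC// size_XsubC addn2/=.
apply: (@sub_finite_set _ _ ([set a] `|` [set x | root r x])).
  by move=> x; rewrite /= pr rootM root_XsubC => /orP[?|/eqP]; [right|left].
by rewrite finite_setU; split; [exact: finite_set1|exact: IH].
Qed.

Section levels.
Context {R : realType}.
Let mu := (@lebesgue_measure R).
Implicit Types (N : nat) (q : {poly R}) (x r : R).

Definition lev N q r : set R := [set x | 0 < x < pi /\ `|form N q x| <= r].

Lemma measurable_lev N q r : measurable (lev N q r).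
Proof.
rewrite (_ : lev N q r = `]0, pi[%classic `&` (fun x => `|form N q x|) @^-1` [set y | y <= r]).
  apply: measurableI; first exact: measurable_itv.
  apply: measurable_realfun.closed_measurable; apply: preimage_closed; last exact: closed_le.
  by move=> x _; apply: continuous_comp; [exact: continuous_form|exact: norm_continuous].
by apply/seteqP; split => x; rewrite /lev /= in_itv.
Qed.

Lemma sub_lev N q r r' : r <= r' -> lev N q r `<=` lev N q r'.
Proof. by move=> rr x [x0 h]; split => //; apply: le_trans h rr. Qed.

Lemma lev_le_pi N q r : (mu (lev N q r) <= (pi : R)%:E)%E.
Proof.
apply: lebesgue_measure_diam; first exact: pi_ge0.
by move=> x y [x0 _] [y0 _]; lra.
Qed.

Lemma lev_fin_num N q r : mu (lev N q r) \is a fin_num.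
Proof. by rewrite ge0_fin_numE ?measure_ge0// (le_lt_trans (lev_le_pi _ _ _))// ltry. Qed.

Lemma cotB x y : 0 < x < pi -> 0 < y < pi ->
  cot x - cot y = sin (y - x) / (sin x * sin y) :> R.
Proof.
move=> /sin_gt0_pi sx /sin_gt0_pi sy; rewrite /cot sinB; field.
by rewrite !gt_eqF.
Qed.

(** The derivative of [cot] is the opposite of the inverse square of [sin], so at least 1 in
    absolute value. *)
Lemma cot_expanding x y : 0 < x < pi -> 0 < y < pi ->
  `|x - y| <= `|cot x - cot y|.
Proof.
wlog xy : x y / x <= y => [wl x0 y0|x0 y0].
  have [xy|/ltW yx] := leP x y; first exact: wl.
  by rewrite distrC (distrC (cot x)); exact: wl.
have [c||c ccd e] := @MVT_segment R cot (fun c => - (sin c)^-2) x y xy.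
- rewrite in_itv/= => cc; apply: is_derive_cot; rewrite gt_eqF// sin_gt0_pi//; lra.
- apply: derivable_within_continuous => c; rewrite in_itv/= => cc.
  suff H : is_derive c 1 (@cot R) (- (sin c)^-2) by [].
  by apply: is_derive_cot; rewrite gt_eqF// sin_gt0_pi//; lra.
rewrite distrC (distrC (cot x)) e normrM ler_peMl// normrN ger0_norm ?invr_ge0 ?exprn_ge0//.
- have : 0 < sin c by apply: sin_gt0_pi; move: ccd; rewrite in_itv/=; lra.
  by move=> s0; rewrite invf_ge1 ?exprn_gt0// exprn_ile1 ?ltW// sin_le1.
- by apply/ltW/sin_gt0_pi; move: ccd; rewrite in_itv/=; lra.
Qed.

(** The expanding map [cot] sends the zeros of the form into the finite set of roots of [q]. *)
Lemma lev0 N q : (size q <= N.+1)%N -> q != 0 -> mu (lev N q 0) = 0.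
Proof.
move=> sq q0; apply/eqP; rewrite eq_le measure_ge0 andbT.
have r0 : mu [set x | root q x] = 0.
  by apply: countable_lebesgue_measure0; exact/finite_set_countable/finite_root.
apply: (@le_trans _ _ (1%:E * mu [set x | root q x])%E); last by rewrite r0 mule0.
apply: (@lebesgue_measure_expanding _ _ _ cot) => //.
- move=> x [x0]; rewrite form_cot// normr_le0 mulf_eq0 expf_eq0 => /orP[/andP[_]|//].
  by rewrite gt_eqF// sin_gt0_pi.
- by move=> x y [x0 _] [y0 _]; rewrite mul1r cot_expanding.
Qed.

(** The form is continuous and has absolute value [|q_N| > r] at both 0 and [pi]. *)
Lemma lev_away N q r : r < `|q`_N| -> exists2 d, 0 < d <= pi / 2 &
  lev N q r `<=` [set x | d <= x <= pi - d].
Proof.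
move=> rq.
have cn : continuous (fun x => `|form N q x|).
  by move=> x; apply: continuous_comp; [exact: continuous_form|exact: norm_continuous].
have H0 : \forall x \near 0, r < `|form N q x|.
  by have := cn 0; rewrite /continuous_at form0 => h; apply: (cvgr_gt _ h).
have Hpi : \forall x \near pi, r < `|form N q x|.
  by have := cn pi; rewrite /continuous_at norm_form_pi => h; apply: (cvgr_gt _ h).
case/nbhs_ballP: H0 => d1 /= d10 h1; case/nbhs_ballP: Hpi => d2 /= d20 h2.
have pi0 := pi_gt0 R.
exists (Num.min (pi / 2) (Num.min d1 d2)).
  by rewrite !lt_min d10 d20 ge_min lexx /= andbT andbT; lra.
move=> x [x0 hx] /=.
have a1 : d1 <= x.
  rewrite leNgt; apply/negP => xd; have := h1 x; rewrite /ball/= sub0r normrN ger0_norm; last lra.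
  by move=> /(_ xd); rewrite ltNge hx.
have a2 : d2 <= pi - x.
  rewrite leNgt; apply/negP => xd; have := h2 x; rewrite /ball/= ger0_norm; last lra.
  by move=> /(_ xd); rewrite ltNge hx.
rewrite ge_min ge_min a1 orbT /=.
suff : Num.min (pi / 2) (Num.min d1 d2) <= pi - x by lra.
by rewrite ge_min ge_min a2 !orbT.
Qed.

End levels.

(** * Existence of a form with the largest level set *)

(** Choose a point in each [S k]: the sequence clusters in [K], and each closed [S k] contains a
    tail of it, hence the cluster point. *)
Lemma nested_compact (T : topologicalType) (K : set T) (S : nat -> set T) :
  compact K -> S 0%N `<=` K -> (forall k, closed (S k)) -> (forall k, S k !=set0) ->
  (forall k l, (k <= l)%N -> S l `<=` S k) -> exists x, forall k, S k x.
Proof.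
move=> cK SK cS S0 dS.
have /choice[c cSk] : forall k, exists x, S k x by move=> k; have [x] := S0 k; exists x.
have Fk k : (c @ \oo) (S k).
  by exists k => // l kl; exact: (dS _ _ kl).
have [|x [_ clx]] := cK (c @ \oo) _.
  by apply: filterS (Fk 0%N).
exists x => k; apply: cS => B Bx.
by have [y [Sy By]] := clx _ _ (Fk k) Bx; exists y.
Qed.

Section maximizer.
Context {R : realType}.
Let mu := (@lebesgue_measure R).
Implicit Types (N : nat) (q : {poly R}) (x r : R).

Definition mlev N q r : R := fine (mu (lev N q r)).

Lemma mlevE N q r : mu (lev N q r) = (mlev N q r)%:E.
Proof. by rewrite fineK// lev_fin_num. Qed.

Lemma mlev_le_pi N q r : mlev N q r <= pi.
Proof. by rewrite -lee_fin -mlevE lev_le_pi. Qed.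

Lemma le_mlev N p q r s : lev N p r `<=` lev N q s -> mlev N p r <= mlev N q s.
Proof.
by move=> h; rewrite -lee_fin -!mlevE; apply: le_measure => //; rewrite inE; exact: measurable_lev.
Qed.

(** The level set at [r] is the decreasing intersection of those at [r + 1 / (k + 1)], all of finite
    measure. *)
Lemma mlev_right_cont N q r v : (forall k, v <= mlev N q (r + k.+1%:R^-1)) -> v <= mlev N q r.
Proof.
move=> h; rewrite -lee_fin -mlevE.
pose F k := lev N q (r + k.+1%:R^-1).
have -> : lev N q r = \bigcap_k F k.
  apply/seteqP; split=> [x xr k _|x xF].
    by apply: sub_lev xr; rewrite lerDl invr_ge0.
  have [x0 _] := xF 0%N I; split=> //; apply/ler_addgt0Pr => e e0.
  near \oo => k; have [_ /le_trans] := xF k I; apply.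
  rewrite lerD2l; apply/ltW; near: k; exact: near_infty_natSinv_lt (PosNum e0).
have cv : mu \o F @ \oo --> mu (\bigcap_k F k).
  apply: nonincreasing_cvg_mu.
  - exact: le_lt_trans (lev_le_pi _ _ _) (ltry _).
  - by move=> i; exact: measurable_lev.
  - by apply: bigcapT_measurable => i; exact: measurable_lev.
  - move=> i j ij; apply/subsetPset; apply: sub_lev.
    by rewrite lerD2l lef_pV2 ?posrE// ler_nat.
rewrite -(cvg_lim _ cv)//; apply: lime_ge; first by apply/cvg_ex; eexists; exact: cv.
by apply: nearW => k; rewrite /= mlevE lee_fin.
Unshelve. all: by end_near. Qed.

Lemma ler_form_dist N p q x : 
  `|form N p x - form N q x| <= \sum_(k < N.+1) `|p`_k - q`_k|.
Proof.
rewrite -formB (le_trans (ler_form _ _ _))//.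
by apply: ler_sum => k _; rewrite coefB.
Qed.

Lemma ler_coord n (c : 'rV[R]_n) i : `|c 0 i| <= `|c|.
Proof.
by rewrite [leRHS]/Num.Def.normr/= mx_normrE; apply/bigmax_geP; right => /=; exists (0, i).
Qed.

(** This is upper semicontinuity in the coefficients. Moving each of the [N + 1] coefficients by
    less than [1 / ((k + 1) (N + 1))] changes the form by at most [1 / (k + 1)], and
    [mlev_right_cont] lets [k] tend to infinity. *)
Lemma closed_mlev N r v :
  closed [set c : 'rV[R]_(N.+1) | v <= mlev N (rVpoly c) r].
Proof.
move=> c clc /=; apply: mlev_right_cont => k.
have e0 : 0 < (k.+1%:R^-1 / N.+1%:R : R) by rewrite divr_gt0// invr_gt0.
have [c' [/= vc']] := clc _ (nbhsx_ballx c _ e0).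
rewrite -ball_normE /= => cc'.
apply: le_trans vc' _; apply: le_mlev => x [x0 xr]; split => //.
rewrite -(subrK (form N (rVpoly c') x) (form N (rVpoly c) x)).
rewrite (le_trans (ler_normD _ _))// addrC lerD//.
rewrite (le_trans (ler_form_dist _ _ _ _))//.
apply: (@le_trans _ _ (\sum_(i < N.+1) (k.+1%:R^-1 / N.+1%:R : R))); last first.
  by rewrite big_const_ord iter_addr_0 -[X in X <= _]mulr_natr divfK.
apply: ler_sum => i _; rewrite !coef_rVpoly_ord.
rewrite (le_trans _ (ltW cc'))//; have := ler_coord (c - c') i.
by rewrite !mxE.
Qed.

Lemma lev_unit N c : `|c| = 1 -> mlev N (rVpoly (c : 'rV[R]_(N.+1))) 0 = 0.
Proof.
move=> c1; apply/eqP; rewrite -eqe -mlevE; apply/eqP; apply: lev0.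
  exact: size_poly.
apply: contra_eq_neq c1 => c0; rewrite (_ : c = 0) ?normr0 1?eq_sym ?oner_eq0//.
by rewrite -[c]rVpolyK c0 linear0.
Qed.

Lemma mlevZ N q r (k : R) : 0 < k -> mlev N (k *: q) (k * r) = mlev N q r.
Proof.
move=> k0; rewrite /mlev; congr (fine (mu _)); apply/seteqP.
by split => x; rewrite /lev/= formZ normrM gtr0_norm// ler_pM2l.
Qed.

(** Normalizing coefficient vectors of unbounded norm gives unit vectors with level sets of measure
    at least [v] at heights tending to 0. Compactness of the unit sphere then yields a nonzero form
    whose zeros have positive measure, against [lev_unit]. *)
Lemma mlev_bounded N v : 0 < v -> exists B : R,
  forall c : 'rV[R]_(N.+1), v <= mlev N (rVpoly c) 1 -> `|c| <= B.
Proof.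
move=> v0; apply: contrapT => nB.
pose S k := [set c : 'rV[R]_(N.+1) | `|c| = 1] `&`
            [set c : 'rV[R]_(N.+1) | v <= mlev N (rVpoly c) k.+1%:R^-1].
have cS1 : closed [set c : 'rV[R]_(N.+1) | `|c| = 1].
  apply: (@preimage_closed _ _ (fun c : 'rV[R]_(N.+1) => `|c|) [set 1]).
    by move=> c _; exact: norm_continuous.
  exact: closed_eq.
have [||k|k|k l kl c [c1 vc]|c cS] := @nested_compact _ [set c : 'rV[R]_(N.+1) | `|c| = 1] S.
- apply: bounded_closed_compact => //.
  by exists 1; split=> // M M1 c /= ->; exact: ltW.
- by move=> c [].
- by apply: closedI => //; exact: closed_mlev.
- apply: contrapT => Sk; apply: nB; exists k.+1%:R => c vc.
  rewrite leNgt; apply/negP => kc; apply: Sk.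
  have c0 : 0 < `|c| by apply: le_lt_trans kc.
  exists (`|c|^-1 *: c); split => /=.
    by rewrite normrZ normfV normr_id mulVf ?gt_eqF.
  rewrite linearZ/=; apply: le_trans vc _.
  rewrite -(@mlevZ _ (rVpoly c) 1 `|c|^-1) ?invr_gt0// mulr1.
  by apply: le_mlev; apply: sub_lev; rewrite lef_pV2 ?posrE// ltW.
- split => //=; apply: le_trans vc _; apply: le_mlev; apply: sub_lev.
  by rewrite lef_pV2 ?posrE// ler_nat.
- have [c1 _] := cS 0%N.
  suff : v <= mlev N (rVpoly c) 0 by rewrite lev_unit// leNgt v0.
  by apply: mlev_right_cont => k; rewrite add0r; have [] := cS k.
Qed.

(** The competitors at least as good as [q0] form a compact set [K]. The sets where the measure is
    within [1 / (k + 1)] of its supremum are closed, nonempty and nested, so a common point attains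
    the supremum. *)
Lemma mlev_maximizer N q0 : (size q0 <= N.+1)%N -> 0 < mlev N q0 1 ->
  exists q, [/\ (size q <= N.+1)%N, q`_N = q0`_N &
    forall p : {poly R}, (size p <= N.+1)%N -> p`_N = q0`_N -> mlev N p 1 <= mlev N q 1].
Proof.
move=> sq0 m0; have [B HB] := mlev_bounded N m0.
pose K := [set c : 'rV[R]_(N.+1) | c 0 ord_max = q0`_N] `&`
          [set c | mlev N q0 1 <= mlev N (rVpoly c) 1].
pose V := [set mlev N (rVpoly c) 1 | c in K].
have Kq0 : K (poly_rV q0).
  split; first by rewrite /= mxE.
  by rewrite /= poly_rV_K.
have supV : has_sup V.
  split; first by exists (mlev N (rVpoly (poly_rV q0 : 'rV_(N.+1))) 1); exists (poly_rV q0).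
  by exists pi => _ [c _ <-]; exact: mlev_le_pi.
have cK : closed K.
  apply: closedI; last exact: closed_mlev.
  apply: (@preimage_closed _ _ (fun c : 'rV[R]_(N.+1) => c 0 ord_max) [set q0`_N]).
    by move=> c _; exact: coord_continuous.
  exact: closed_eq.
have compK : compact K.
  apply: bounded_closed_compact => //.
  exists B; split=> [|M BM c [_ vc]]; first exact: num_real.
  by apply: le_trans (HB _ vc) _; exact: ltW.
pose S k := K `&` [set c | sup V - k.+1%:R^-1 <= mlev N (rVpoly c) 1].
have [|k|k|k l kl c [c1 vc]|c cS] := @nested_compact _ K S compK.
- by move=> c [].
- by apply: closedI => //; exact: closed_mlev.
- have [|_ [c Kc <-] h] := sup_adherent (_ : 0 < k.+1%:R^-1) supV; first by rewrite invr_gt0.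
  by exists c; split => //=; exact: ltW.
- split => //=; apply: le_trans vc; rewrite lerB// lef_pV2 ?posrE// ler_nat//.
have [[cN _] _] := cS 0%N.
exists (rVpoly c); split.
- exact: size_poly.
- by rewrite -cN -coef_rVpoly_ord.
move=> p sp pN; have [pq|/ltW qp] := leP (mlev N p 1) (mlev N q0 1).
  by apply: le_trans pq _; have [[_ ]] := cS 0%N.
apply: (@le_trans _ _ (sup V)).
  apply: sup_upper_bound => //; exists (poly_rV p); last by rewrite poly_rV_K.
  by split; rewrite /= ?mxE ?poly_rV_K.
apply/ler_addgt0Pr => e e0; near \oo => k.
have [_ /= h] := cS k.
rewrite -lerBlDr (le_trans _ h)// lerB//.
by apply/ltW; near: k; exact: near_infty_natSinv_lt (PosNum e0).
Unshelve. all: by end_near. Qed.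

End maximizer.

(** * Enlarging a level set *)

Section perturbation.
Context {R : realType}.
Let mu := (@lebesgue_measure R).
Implicit Types (N : nat) (q : {poly R}) (x r : R).

(** The map need only expand on each of the two parts cut out by [H]: their images lie in the
    disjoint parts of [B] cut out by [H'], so the two estimates add up. *)
Lemma split_expanding (A B H H' : set R) (f : R -> R) (K : R) :
  measurable A -> measurable B -> measurable H -> measurable H' -> 0 < K ->
  (forall x, A x -> B (f x)) -> (forall x, A x -> H x <-> H' (f x)) ->
  (forall x y, A x -> A y -> (H x <-> H y) -> `|x - y| <= K * `|f x - f y|) ->
  (mu A <= K%:E * mu B)%E.
Proof.
move=> mA mB mH mH' K0 AB HH' fK.
have split_mu (C G : set R) : measurable C -> measurable G ->
    mu C = (mu (C `&` G) + mu (C `&` ~` G))%E.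
  move=> mC mG; rewrite -measureU; first by rewrite -setIUr setUv setIT.
  - exact: measurableI.
  - by apply: measurableI => //; exact: measurableC.
  - by rewrite setIACA setICr setI0.
rewrite (split_mu A H)// (split_mu B H')// muleDr ?ge0_adde_def ?inE//.
apply: leeD; apply: (@lebesgue_measure_expanding _ _ _ f) => //.
- by move=> x [Ax Hx]; split; [exact: AB|apply/HH'].
- by move=> x y [Ax Hx] [Ay Hy]; exact: fK.
- by move=> x [Ax Hx]; split; [exact: AB|move/(HH' _ Ax)].
- by move=> x y [Ax Hx] [Ay Hy]; exact: fK.
Qed.

Lemma ler_sin x : `|sin x| <= `|x|.
Proof.
wlog x0 : x / 0 <= x => [wl|].
  have [/wl//|/ltW x0] := leP 0 x; have := wl (- x).
  by rewrite sinN !normrN; apply; lra.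
have [|c _] := @MVT_segment R sin cos 0 x x0.
  by apply: continuous_subspaceT; exact: continuous_sin.
rewrite sin0 !subr0 => ->; rewrite normrM ler_piMl//; exact: cos_max.
Qed.

Lemma cot_lt x y : 0 < x -> x < y -> y < pi -> cot y < cot x.
Proof.
move=> x0 xy ypi; rewrite -subr_gt0 cotB; try lra.
by apply: divr_gt0; rewrite ?mulr_gt0//; apply: sin_gt0_pi; lra.
Qed.

Lemma sin_lower (d : R) : 0 < d <= pi / 2 -> exists2 s, 0 < s &
  forall x, d <= x <= pi - d -> s <= sin x.
Proof.
move=> d0; have [||c + hc] := @EVT_min R sin d (pi - d); first lra.
  by apply: continuous_subspaceT; exact: continuous_sin.
rewrite in_itv/= => cc; exists (sin c); first by apply: sin_gt0_pi; lra.
by move=> x xd; apply: hc; rewrite in_itv/=.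
Qed.

Lemma cot_lipschitz (d : R) : 0 < d <= pi / 2 -> exists2 L, 0 <= L &
  forall x y, d <= x <= pi - d -> d <= y <= pi - d -> `|cot x - cot y| <= L * `|x - y|.
Proof.
move=> d0; have [s s0 hs] := sin_lower d0.
exists (s ^- 2); first by rewrite invr_ge0 exprn_ge0// ltW.
move=> x y xd yd; have sx := hs _ xd; have sy := hs _ yd.
rewrite cotB; try lra.
rewrite normrM mulrC ler_pM//; last by rewrite distrC ler_sin.
rewrite ger0_norm ?invr_ge0 ?mulr_ge0//; try lra.
rewrite lef_pV2 ?posrE ?mulr_gt0 ?exprn_gt0//; try lra.
by rewrite expr2 ler_pM//; lra.
Qed.

Lemma cot_bounded (d : R) : 0 < d <= pi / 2 -> exists2 C, 0 < C &
  forall x, d <= x <= pi - d -> `|cot x| <= C.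
Proof.
move=> d0; have [s s0 hs] := sin_lower d0.
exists (s^-1) => [|x xd]; first by rewrite invr_gt0.
have sx := hs _ xd; rewrite normrM (@le_trans _ _ (1 * (s^-1)))//; last by rewrite mul1r.
rewrite ler_pM ?cos_max// ger0_norm ?lef_pV2 ?posrE//; first lra.
by rewrite invr_ge0; lra.
Qed.

Lemma exprn_lipschitz (B : R) e : 0 <= B -> exists2 L, 0 <= L &
  forall u v, `|u| <= B -> `|v| <= B -> `|u ^+ e - v ^+ e| <= L * `|u - v|.
Proof.
move=> B0; elim: e => [|e [L L0 IH]].
  by exists 0 => // u v _ _; rewrite subrr normr0 mul0r.
exists (B * L + B ^+ e) => [|u v uB vB]; first by rewrite addr_ge0 ?mulr_ge0 ?exprn_ge0.
have -> : u ^+ e.+1 - v ^+ e.+1 = u * (u ^+ e - v ^+ e) + v ^+ e * (u - v).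
  by rewrite !exprS; ring.
rewrite (le_trans (ler_normD _ _))// mulrDl lerD//.
  by rewrite normrM -mulrA ler_pM// IH.
by rewrite normrM ler_wpM2r// normrX lerXn2r// nnegrE.
Qed.

Lemma dform_eq0 N q : (size q <= N.+1)%N -> dform N q = 0 ->
  forall x y, 0 < x < pi -> 0 < y < pi -> form N q x = form N q y.
Proof.
move=> sq D0 x y x0 y0; have [c _] := MVT_form sq x0 y0.
rewrite D0 -(scale0r (0 : {poly R})) formZ !mul0r => /eqP.
by rewrite subr_eq0 => /eqP.
Qed.

(** This supplies the step of [lev_perturb]: displacements bounded by [eps * B] cross neither the
    critical point nor the ends of the interval, [1 - eps * eta] is nonnegative, and the error
    [eps ^ 2 * C] is at most [eps * eta]. *)
Lemma exists_small_step (a b B eta C : R) :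
  0 < a -> 0 < b -> 0 < B -> 0 < eta -> 0 <= C ->
  exists eps, [/\ 0 < eps, eps * B < a, eps * B < b, eps * eta <= 1 & eps * C <= eta].
Proof.
move=> a0 b0 B0 eta0 C0.
exists (Num.min (Num.min (a / (2 * B)) (b / (2 * B))) (Num.min (eta^-1) (eta / (C + 1)))).
have C1 : 0 < C + 1 by lra.
have B2 : 0 < 2 * B by lra.
set m := Num.min _ _.
have m1 : m <= a / (2 * B) by rewrite /m !ge_min lexx.
have m2 : m <= b / (2 * B) by rewrite /m !ge_min lexx orbT.
have m3 : m <= eta^-1 by rewrite /m !ge_min lexx !orbT.
have m4 : m <= eta / (C + 1) by rewrite /m !ge_min lexx !orbT.
have mp : 0 < m by rewrite /m !lt_min invr_gt0 eta0 !divr_gt0.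
rewrite ler_pdivlMr// in m1; rewrite ler_pdivlMr// in m2.
rewrite ler_pdivlMr// in m4; rewrite -[eta^-1]mul1r ler_pdivlMr// in m3.
split=> //; [lra|lra|].
by apply: le_trans m4; rewrite ler_pM2l//; lra.
Qed.

(* With [P = form N q], [u = cot] and [D1 = P' / (u - u x1)], a form of lower order,
   the form [P - eps D1] takes nearly the value [P x] at [x + eps / (u x - u x1)],
   and this displacement expands the level set on both sides of [x1].  The error is
   [O(eps ^ 2)], which is not harmless where [P] touches the level [1]; it is absorbed
   by the further term [eps eta (h P' - P)], where [h = k u ^ e] is chosen so that the
   coefficient of degree [N] is unchanged. *)
Lemma lev_perturb N q x1 : (size q <= N.+1)%N -> 1 < `|q`_N| ->
  0 < mlev N q 1 -> 0 < x1 < pi -> form N (dform N q) x1 = 0 ->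
  1 < `|form N q x1| ->
  exists p : {poly R}, [/\ (size p <= N.+1)%N, p`_N = q`_N &
    mlev N q 1 < mlev N p 1].
Proof.
move=> sq qN m0 x10 dx1 Px1.
set E := lev N q 1.
have [x0 Ex0] : E !=set0.
  apply/set0P; apply/eqP => E0; move: m0.
  by rewrite /mlev -/E E0 measure0 ltxx.
have E0pi x : E x -> 0 < x < pi by case.
set D := dform N q in dx1 *.
have sD : (size D <= N.+1)%N by exact: size_dform.
have D0 : D != 0.
  apply/eqP => D0; have [x00 h] := Ex0.
  by move: h; rewrite (dform_eq0 sq D0 x00 x10) leNgt Px1.
set u1 := cot x1.
have [D1 DE] : exists D1, D = D1 * ('X - u1%:P).
  apply/factor_theorem; move: dx1; rewrite form_cot// => /eqP.
  by rewrite mulf_eq0 expf_eq0 gt_eqF ?andbF ?sin_gt0_pi.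
have D10 : D1 != 0 by apply: contraNneq D0 => h; rewrite DE h mul0r.
have sD1 : (size D1 <= N)%N.
  by move: sD; rewrite DE size_Mmonic ?monicXsubC// size_XsubC addn2.
(* The power [e] raises [D] to degree exactly [N], and [k] matches its leading coefficient with the
   coefficient of degree [N] of [q]; they cancel in [g]. *)
set e := (N.+1 - size D)%N; set k := q`_N / lead_coef D.
set g := k *: ('X^e * D) - q.
have sXD : size ('X^e * D) = N.+1.
  by rewrite mulrC size_mulXn// /e; lia.
have gN : g`_N = 0.
  rewrite coefB coefZ (_ : N = (size ('X^e * D)).-1); last by rewrite sXD.
  rewrite -[_`_ _]/(lead_coef _) lead_coefM lead_coefXn mul1r sXD /=.
  by rewrite divfK ?lead_coef_eq0// subrr.
have sg : (size g <= N.+1)%N.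
  rewrite (leq_trans (size_polyD _ _))// geq_max size_polyN sq andbT.
  by rewrite (leq_trans (size_scale_leq _ _))// sXD.
have sD1' : (size D1 <= N.+1)%N by apply: leqW.
have formD1 x : 0 < x < pi -> form N D x = form N D1 x * (cot x - u1).
  by move=> xx; rewrite !form_cot// DE hornerM hornerXsubC mulrA.
have formg x : 0 < x < pi -> form N g x = k * cot x ^+ e * form N D x - form N q x.
  move=> xx; rewrite formB formZ !form_cot ?sXD// hornerM hornerXn; ring.
have [d d0 Ed] := lev_away qN.
have [k1 k10 Ek1] : exists2 k1, 0 < k1 & forall x, E x -> k1 <= `|x - x1|.
  have cn : continuous (fun x => `|form N q x|).
    by move=> x; apply: continuous_comp; [exact: continuous_form|exact: norm_continuous].
  have : \forall x \near x1, 1 < `|form N q x| by apply: (cvgr_gt _ (cn x1)).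
  case/nbhs_ballP => k1 /= k10 h; exists k1 => // x [x00 hx].
  rewrite leNgt; apply/negP => xk; have := h x; rewrite /ball/= distrC => /(_ xk).
  by rewrite ltNge hx.
have [Lc Lc0 cotL] := cot_lipschitz d0.
have [C1 C10 cotC] := cot_bounded d0.
have [Le Le0 expL] := exprn_lipschitz e (ltW C10).
pose V x := (cot x - u1)^-1; pose h x := k * cot x ^+ e.
set Lh := `|k| * (Le * Lc).
have Lh0 : 0 <= Lh by rewrite !mulr_ge0.
have hL x y : E x -> E y -> `|h x - h y| <= Lh * `|x - y|.
  move=> /Ed xd /Ed yd; rewrite -mulrBr normrM -mulrA ler_wpM2l//.
  rewrite (le_trans (expL _ _ (cotC _ xd) (cotC _ yd)))// -mulrA ler_wpM2l//.
  exact: cotL.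
have cotu1 x : E x -> k1 <= `|cot x - u1|.
  by move=> Ex; rewrite (le_trans (Ek1 _ Ex))// cot_expanding//; exact: E0pi.
have cotu10 x : E x -> cot x - u1 != 0.
  by move=> Ex; rewrite -normr_gt0 (lt_le_trans k10)// cotu1.
have VB x y : E x -> E y -> V x - V y = (cot y - cot x) / ((cot x - u1) * (cot y - u1)).
  by move=> Ex Ey; rewrite /V; field; rewrite !cotu10.
set LV := Lc / k1 ^+ 2.
have LV0 : 0 <= LV by rewrite divr_ge0// exprn_ge0// ltW.
have VL x y : E x -> E y -> `|V x - V y| <= LV * `|x - y|.
  move=> Ex Ey; rewrite VB// normrM /LV mulrAC distrC ler_pM//.
    by apply: cotL; exact: Ed.
  rewrite normfV lef_pV2 ?posrE ?exprn_gt0// ?normr_gt0 ?mulf_neq0 ?cotu10//.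
  by rewrite normrM expr2 ler_pM ?cotu1// ltW.
set C0 := C1 + `|u1|.
have C00 : 0 < C0 by rewrite ltr_pwDl.
set c0 := (C0 ^+ 2)^-1.
have c00 : 0 < c0 by rewrite invr_gt0 exprn_gt0.
(* In the quotient given by [VB], for points on the same side of [x1], the denominator is positive
   and at most [C0 ^ 2], while the numerator is at least [y - x]. *)
have VE x y : E x -> E y -> (x < x1) = (y < x1) -> x <= y -> c0 * (y - x) <= V y - V x.
  move=> Ex Ey xy1 xy; have x00 := E0pi _ Ex; have y00 := E0pi _ Ey.
  have x1x : x != x1.
    by apply: contraTneq (Ek1 _ Ex) => ->; rewrite subrr normr0 -ltNge.
  have y1y : y != x1.
    by apply: contraTneq (Ek1 _ Ey) => ->; rewrite subrr normr0 -ltNge.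
  have pos : 0 < (cot y - u1) * (cot x - u1).
    have [xx1|xx1] := ltP x x1.
      have yx1 : y < x1 by rewrite -xy1.
      by rewrite mulr_gt0// subr_gt0 cot_lt//; move: x00 y00 x10 => /andP[? ?] /andP[? ?] /andP[].
    have {}xx1 : x1 < x by rewrite lt_neqAle eq_sym x1x.
    have yx1 : x1 < y by exact: lt_le_trans xy.
    by rewrite nmulr_rgt0 subr_lt0 cot_lt//; move: x00 y00 x10 => /andP[? ?] /andP[? ?] /andP[].
  rewrite VB// mulrC ler_pM//; first by rewrite subr_ge0.
  - by rewrite ltW.
  - have := cot_expanding x00 y00.
    rewrite distrC ger0_norm ?subr_ge0// => /le_trans; apply.
    move: xy; rewrite le_eqVlt => /predU1P[->|xy]; first by rewrite subrr normr0.
    by rewrite ger0_norm// subr_ge0 ltW// cot_lt//; move: x00 y00 => /andP[? ?] /andP[].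
  - rewrite lef_pV2 ?posrE ?exprn_gt0// -[leLHS](gtr0_norm pos) normrM expr2.
    have B z : E z -> `|cot z - u1| <= C0.
      by move=> Ez; rewrite (le_trans (ler_normB _ _))// lerD2r; exact/cotC/Ed.
    by rewrite ler_pM// B.
(* With this [eta] the correction [eta * h] costs at most half of the growth rate [c0] of [V]. *)
pose eta := c0 / (2 * (Lh + 1)).
have Lh2 : 0 < 2 * (Lh + 1) by move: Lh0; clear; lra.
have eta0 : 0 < eta by rewrite divr_gt0.
have etaLh : eta * Lh <= c0 / 2.
  rewrite /eta mulrAC ler_pdivrMr//.
  by rewrite (_ : c0 / 2 * _ = c0 * Lh + c0); [rewrite lerDl ltW|field].
pose W x := V x - eta * h x.
have WB x y : W y - W x = (V y - V x) - eta * (h y - h x) by rewrite /W; ring.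
set LW := LV + eta * Lh.
have LW0 : 0 <= LW by rewrite addr_ge0// mulr_ge0// ltW.
have WL x y : E x -> E y -> `|W y - W x| <= LW * `|y - x|.
  move=> Ex Ey; rewrite WB (le_trans (ler_normB _ _))// mulrDl lerD ?VL//.
  by rewrite normrM (gtr0_norm eta0) -(mulrA eta) (ler_pM2l eta0) hL.
have WE x y : E x -> E y -> (x < x1) = (y < x1) -> x <= y -> c0 / 2 * (y - x) <= W y - W x.
  move=> Ex Ey xy1 xy; rewrite WB.
  have H1 := VE _ _ Ex Ey xy1 xy.
  have H2 : eta * (h y - h x) <= c0 / 2 * (y - x).
    rewrite (@le_trans _ _ (eta * (Lh * `|y - x|)))//.
      by rewrite ler_pM2l// (le_trans (ler_norm _))// hL.
    by rewrite ger0_norm ?subr_ge0// mulrA ler_wpM2r// subr_ge0.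
  by move: H1 H2; clear; lra.
have [B B0 WBd] : exists2 B, 0 < B & forall x, E x -> `|W x| <= B.
  exists (`|W x0| + LW * pi + 1) => [|x Ex].
    by rewrite ltr_pwDr// addr_ge0// mulr_ge0// pi_ge0.
  have := ler_normD (W x - W x0) (W x0); rewrite subrK => /le_trans; apply.
  suff : `|W x - W x0| <= LW * pi by clear; lra.
  apply: le_trans (WL _ _ Ex0 Ex) _; apply: ler_wpM2l => //.
  by have := E0pi _ Ex; have := E0pi _ Ex0; rewrite ler_norml; clear; lra.
have [T1 T10 taylor] := taylor_form sq.
have [T2 T20 lipD1] := lipschitz_form sD1'.
have [T3 T30 lipg] := lipschitz_form sg.
(* The three terms bound the Taylor error of [q] and the variations of [D1] and [g] along the
   displacement, after division by [eps ^ 2]. *)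
set C := T1 * B ^+ 2 + T2 * B + eta * (T3 * B).
have C_0 : 0 <= C.
  by have ? := ltW B0; have ? := ltW eta0; rewrite /C; repeat first [assumption | apply: addr_ge0 | apply: exprn_ge0 | apply: mulr_ge0].
have dp : 0 < d by case/andP: d0.
have [eps [eps0 epsk1 epsd epseta epsC]] := exists_small_step k10 dp B0 eta0 C_0.
pose F x := x + eps * W x.
have epsW x : E x -> `|eps * W x| <= eps * B.
  by move=> Ex; rewrite normrM gtr0_norm// ler_pM2l// WBd.
set p := q - eps *: D1 + (eps * eta) *: g.
have sp : (size p <= N.+1)%N.
  rewrite (leq_trans (size_polyD _ _))// geq_max (leq_trans (size_polyD _ _)) ?geq_max ?sq ?size_polyN//=.
    by rewrite (leq_trans (size_scale_leq _ _)).
  by rewrite (leq_trans (size_scale_leq _ _)).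
have pN : p`_N = q`_N.
  rewrite coefD coefB !coefZ gN mulr0 addr0.
  by rewrite (nth_default _ sD1) mulr0 subr0.
exists p; split => //.
have FE x : E x -> lev N p 1 (F x).
  move=> Ex; have x00 := E0pi _ Ex; have xd := Ed _ Ex.
  have := epsW _ Ex; rewrite ler_norml => eW.
  have y00 : 0 < F x < pi by rewrite /F; move: xd eW epsd dp => /=; clear; lra.
  split => //.
  have yx : F x - x = eps * W x by rewrite /F addrC addKr.
  have R1 := taylor _ _ x00 y00.
  have R2 := lipD1 _ _ x00 y00.
  have R3 := lipg _ _ x00 y00.
  rewrite yx in R1 R2 R3; rewrite -/D in R1.
  set r1 := _ - _ - _ in R1; set r2 := _ - _ in R2; set r3 := _ - _ in R3.
  (* To first order [q] gains [eps * W x] times its derivative [D]. The part from [V] cancels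
     [eps *: D1] and the part from [h] cancels the [h]-term of [g]; only [- eps * eta] times the
     value of [q] survives. *)
  have -> : form N p (F x) = (1 - eps * eta) * form N q x
      + (r1 - eps * r2 + eps * eta * r3).
    rewrite /p formD formB !formZ /r1 /r2 /r3 (formg x x00) (formD1 x x00) /W /V /h.
    by field; exact: cotu10.
  have [_ qx] := Ex.
  have n1 : `|(1 - eps * eta) * form N q x| <= 1 - eps * eta.
    have e0 : 0 <= 1 - eps * eta by rewrite subr_ge0.
    by rewrite normrM (ger0_norm e0) ler_piMr.
  have e2 : (eps * W x) ^+ 2 <= eps ^+ 2 * B ^+ 2.
    rewrite -exprMn -real_normK ?num_real// lerXn2r ?nnegrE ?epsW//.
    by rewrite mulr_ge0 ?ltW.
  have n2 : `|r1| <= T1 * (eps ^+ 2 * B ^+ 2).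
    by rewrite (le_trans R1)// ler_wpM2l.
  have n3 : `|r2| <= T2 * (eps * B).
    by rewrite (le_trans R2)// ler_wpM2l// epsW.
  have n4 : `|r3| <= T3 * (eps * B).
    by rewrite (le_trans R3)// ler_wpM2l// epsW.
  have n5 : `|r1 - eps * r2 + eps * eta * r3| <= eps ^+ 2 * C.
    rewrite (le_trans (ler_normD _ _))// (_ : eps ^+ 2 * C = (T1 * (eps ^+ 2 * B ^+ 2)
      + eps * (T2 * (eps * B))) + eps * eta * (T3 * (eps * B))); last by rewrite /C; ring.
    have ee0 : 0 < eps * eta by exact: mulr_gt0.
    apply: lerD; last by rewrite normrM (gtr0_norm ee0) (ler_pM2l ee0).
    rewrite (le_trans (ler_normB _ _))// lerD//.
    by rewrite normrM (gtr0_norm eps0) (ler_pM2l eps0).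
  have n6 : eps ^+ 2 * C <= eps * eta by rewrite expr2 -mulrA (ler_pM2l eps0).
  rewrite (le_trans (ler_normD _ _))//; move: n1 n5 n6; clear; lra.
set K := (1 + eps * (c0 / 2))^-1.
have K1 : 0 < 1 + eps * (c0 / 2) by rewrite ltr_wpDr// mulr_ge0 ?divr_ge0 ?ltW.
have K0 : 0 < K by rewrite invr_gt0.
have side x : E x -> (x <= x1 - k1) \/ (x1 + k1 <= x).
  move=> Ex; have := Ek1 _ Ex; have [xx|xx] := ltP x x1.
    by rewrite ltr0_norm ?subr_lt0// => h1; left; move: h1; clear; lra.
  by rewrite ger0_norm ?subr_ge0// => h1; right; move: h1; clear; lra.
have : (mu E <= K%:E * mu (lev N p 1))%E.
  (* Points of [E] are at distance at least [k1] from [x1] and move by at most [eps * B < k1], so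
     [F] keeps them on their side. *)
  apply: (@split_expanding _ _ `]-oo, x1[ `]-oo, x1[ F K) => //.
  - exact: measurable_lev.
  - exact: measurable_lev.
  - move=> x Ex; rewrite /= !in_itv/=; have := epsW _ Ex; rewrite ler_norml /F => eW.
    by case: (side x Ex) => xs; split; move: xs eW epsk1 k10; clear; lra.
  - move=> x y Ex Ey /=; rewrite !in_itv/= => xy1.
    have {}xy1 : (x < x1) = (y < x1) by apply/idP/idP; case: xy1.
    wlog xy : x y Ex Ey xy1 / x <= y => [wl|].
      have [xy|/ltW yx] := leP x y; first exact: wl.
      by rewrite distrC (distrC (F x)); exact: wl.
    rewrite mulrC ler_pdivlMr// distrC (distrC (F x)) ger0_norm ?subr_ge0//.
    rewrite (le_trans _ (ler_norm _))// /F.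
    have := WE _ _ Ex Ey xy1 xy; rewrite -(ler_pM2l eps0); clear; lra.
rewrite /E /mu !mlevE -EFinM lee_fin => mE.
rewrite (le_lt_trans mE)// gtr_pMl ?invf_lt1//; last first.
  rewrite -(pmulr_rgt0 _ K0); exact: lt_le_trans mE.
by rewrite ltrDl mulr_gt0// divr_gt0.
Qed.

End perturbation.

(** * Lagrange interpolation and Chebyshev polynomials *)

Section lagrange.
Context {F : realFieldType}.
Implicit Types (N : nat) (p q : {poly F}).

Lemma poly_eq_at N (p q : {poly F}) (u : 'I_N.+1 -> F) : injective u ->
  (size p <= N.+1)%N -> (size q <= N.+1)%N -> (forall j, p.[u j] = q.[u j]) -> p = q.
Proof.
move=> uI sp sq pq; apply/eqP; rewrite -subr_eq0; apply/eqP.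
apply: (@roots_geq_poly_eq0 _ _ [seq u j | j <- enum 'I_N.+1]).
- by apply/allP => _ /mapP[j _ ->]; rewrite /root hornerD hornerN pq subrr.
- by rewrite map_inj_uniq// enum_uniq.
- rewrite size_map size_enum_ord (leq_trans (size_polyD _ _))// geq_max sp.
  by rewrite size_polyN.
Qed.

Definition lagrange_den N (u : 'I_N.+1 -> F) j := \prod_(i | i != j) (u j - u i).

(** Take the coefficient of degree [N] in Lagrange's formula, where each nodal product [L j] is
    monic of degree [N]. *)
Lemma lagrange_lead N q (u : 'I_N.+1 -> F) : injective u -> (size q <= N.+1)%N ->
  q`_N = \sum_j q.[u j] / lagrange_den u j.
Proof.
move=> uI sq; pose L j := \prod_(i | i != j) ('X - (u i)%:P).
have sL j : size (L j) = N.+1.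
  rewrite /L -big_filter size_prod_XsubC size_filter -sum1_count sum1_card.
  by rewrite cardC1 card_ord.
have LN j : (L j)`_N = 1.
  have /monicP : L j \is monic by exact: monic_prod_XsubC.
  by rewrite /lead_coef sL.
have Lu j i : (L j).[u i] = if i == j then lagrange_den u j else 0.
  rewrite horner_prod; case: eqVneq => [->|ij].
    by apply: eq_bigr => k _; rewrite hornerXsubC.
  by rewrite (bigD1 i)//= hornerXsubC subrr mul0r.
have den0 j : lagrange_den u j != 0.
  by apply/prodf_neq0 => i ij; rewrite subr_eq0 (inj_eq uI) eq_sym.
have {1}-> : q = \sum_j (q.[u j] / lagrange_den u j) *: L j.
  apply: (poly_eq_at uI) => // [|i].
    apply: (leq_trans (size_sum _ _ _)); apply/bigmax_leqP => j _.
    by rewrite (leq_trans (size_scale_leq _ _))// sL.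
  rewrite horner_sum (bigD1 i)//= big1 => [|j ji].
    by rewrite hornerZ Lu eqxx divfK// addr0.
  by rewrite hornerZ Lu eq_sym (negbTE ji) mulr0.
rewrite coef_sum; apply: eq_bigr => j _.
by rewrite coefZ LN mulr1.
Qed.

(** Exactly [j] nodes exceed [u j], and each contributes one negative factor. *)
Lemma lagrange_den_sign N (u : 'I_N.+1 -> F) (j : 'I_N.+1) :
  (forall i k : 'I_N.+1, (i < k)%N -> u k < u i) -> 0 < (-1) ^+ j * lagrange_den u j.
Proof.
move=> dec; rewrite /lagrange_den.
have -> : \prod_(i | i != j) (u j - u i) =
    (-1) ^+ j * \prod_(i | i != j) `|u j - u i|.
  have -> : (-1 : F) ^+ j = \prod_(i : 'I_N.+1 | i != j) (-1) ^+ (i < j)%N.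
    rewrite prodrXr; congr (_ ^+ _).
    rewrite -[LHS](card_ord j) -sum1_card (big_ord_widen N.+1 (fun=> 1%N)) 1?ltnW//.
    rewrite [LHS]big_mkcond [RHS]big_mkcond/=; apply: eq_bigr => i _.
    by rewrite -val_eqE/=; case: ltngtP.
  rewrite -big_split; apply: eq_bigr => i ij /=.
  have [ilj|jli] := ltnP i j.
    by rewrite ltr0_norm ?subr_lt0 ?dec// expr1 mulN1r opprK.
  rewrite gtr0_norm ?mul1r// subr_gt0 dec// ltn_neqAle jli andbT.
  by rewrite eq_sym.
rewrite mulrA -expr2 sqrr_sign mul1r; apply: prodr_gt0 => i ij.
rewrite normr_gt0 subr_eq0; move: ij; rewrite -val_eqE/=.
by case: ltngtP => // /dec h _; [rewrite lt_eqF|rewrite gt_eqF].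
Qed.

(** The interpolation weights alternate in sign, so [p], which alternates with full amplitude,
    maximizes the leading coefficient term by term. Equality forces agreement at all [N + 1]
    nodes. *)
Lemma alternating_lead N (u : 'I_N.+1 -> F) (w : 'I_N.+1 -> F) p q :
  (forall i k : 'I_N.+1, (i < k)%N -> u k < u i) ->
  (size p <= N.+1)%N -> (size q <= N.+1)%N ->
  (forall j : 'I_N.+1, p.[u j] = (-1) ^+ j * w j) -> (forall j, `|q.[u j]| <= w j) ->
  q`_N <= p`_N /\ (q`_N = p`_N -> q = p).
Proof.
move=> dec sp sq pu qu.
have uI : injective u.
  move=> i k uik; apply/val_inj; case: (ltngtP i k) => // /dec; by rewrite uik ltxx.
pose A (j : 'I_N.+1) := (-1) ^+ j * lagrange_den u j.
have A0 (j : 'I_N.+1) : 0 < A j by exact: lagrange_den_sign.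
have AE (j : 'I_N.+1) : (lagrange_den u j)^-1 = (-1) ^+ j / A j.
  by rewrite /A invfM mulrA divff ?signr_eq0 ?mul1r.
have dE : p`_N - q`_N = \sum_(j < N.+1) (w j - (-1) ^+ j * q.[u j]) / A j.
  rewrite (lagrange_lead uI sp) (lagrange_lead uI sq) -sumrB; apply: eq_bigr => j _.
  by rewrite AE pu mulrACA -expr2 sqrr_sign mul1r mulrBl mulrCA mulrA.
have t0 (j : 'I_N.+1) : 0 <= w j - (-1) ^+ j * q.[u j].
  by rewrite subr_ge0 (le_trans (ler_norm _))// normrMsign.
have s0 (j : 'I_N.+1) : 0 <= (w j - (-1) ^+ j * q.[u j]) / A j.
  by rewrite divr_ge0// ltW.
split; first by rewrite -subr_ge0 dE sumr_ge0.
move=> e; apply: (poly_eq_at uI) => // j.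
have : \sum_(j < N.+1) (w j - (-1) ^+ j * q.[u j]) / A j = 0 by rewrite -dE e subrr.
move=> /eqP; rewrite psumr_eq0// => /allP/(_ j); rewrite mem_index_enum => /(_ isT).
rewrite mulf_eq0 invr_eq0 (gt_eqF (A0 j)) orbF subr_eq0 => /eqP wE.
by rewrite pu wE mulrA -expr2 sqrr_sign mul1r.
Qed.

End lagrange.

Section chebyshev.
Context {R : realType}.
Implicit Types (k : nat) (x : R).

(** Carrying two consecutive Chebyshev polynomials makes the three-term recurrence structural. *)
Fixpoint cheb2 k : {poly R} * {poly R} :=
  if k is k'.+1 then let: (T, U) := cheb2 k' in (U, 2%:R *: ('X * U) - T)
  else (1, 'X).

Definition cheb k := (cheb2 k).1.

Lemma cheb0 : cheb 0 = 1. Proof. by []. Qed.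

Lemma cheb1 : cheb 1 = 'X. Proof. by []. Qed.

Lemma chebSS k : cheb k.+2 = 2%:R *: ('X * cheb k.+1) - cheb k.
Proof. by rewrite /cheb /=; case: cheb2. Qed.

Lemma nat_ind2 (P : nat -> Prop) : P 0%N -> P 1%N ->
  (forall k, P k -> P k.+1 -> P k.+2) -> forall k, P k.
Proof.
move=> P0 P1 PS k; suff [] : P k /\ P k.+1 by [].
by elim: k => // k [Pk PSk]; split => //; exact: PS.
Qed.

Lemma horner_chebSS k x : (cheb k.+2).[x] = 2 * x * (cheb k.+1).[x] - (cheb k).[x].
Proof. by rewrite chebSS hornerD hornerN hornerZ hornerM hornerX mulrA. Qed.

Lemma size_cheb k : (size (cheb k) <= k.+1)%N.
Proof.
elim/nat_ind2: k => [||k IH0 IH1]; [by rewrite size_poly1|by rewrite size_polyX|].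
rewrite chebSS (leq_trans (size_polyD _ _))// size_polyN geq_max.
rewrite (leq_trans IH0) ?andbT; last by rewrite ltnW// ltnW.
rewrite (leq_trans (size_scale_leq _ _))// (leq_trans (size_polyMleq _ _))//.
by rewrite size_polyX.
Qed.

Lemma cheb_cos k x : (cheb k).[cos x] = cos (k%:R * x).
Proof.
elim/nat_ind2: k => [||k IH0 IH1].
- by rewrite hornerC mul0r cos0.
- by rewrite hornerX mul1r.
rewrite horner_chebSS IH0 IH1.
have -> : k.+2%:R * x = k.+1%:R * x + x by rewrite -[k.+2]addn1 natrD mulrDl mul1r.
have -> : k%:R * x = k.+1%:R * x - x by rewrite -[k.+1]addn1 natrD mulrDl mul1r addrK.
by rewrite (cosB (k.+1%:R * x)) (cosD (k.+1%:R * x)); ring.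
Qed.

(** When [x * y = 1] the right-hand side obeys the Chebyshev recurrence at [(x + y) / 2]. It is used
    with the sum and the difference of [sec] and [tan]. *)
Lemma cheb_joukowski k x y : x * y = 1 -> (cheb k).[(x + y) / 2] = (x ^+ k + y ^+ k) / 2.
Proof.
move=> xy; elim/nat_ind2: k => [||k IH0 IH1].
- by rewrite hornerC !expr0 -[X in X / 2]/(2%:R) divff.
- by rewrite hornerX.
rewrite horner_chebSS IH0 IH1.
rewrite (_ : 2 * _ * _ = (x ^+ k.+2 + y ^+ k.+2 + x * y * (x ^+ k + y ^+ k)) / 2).
  by rewrite xy; field.
by rewrite !exprS; field.
Qed.

Lemma chebN k x : (cheb k).[- x] = (-1) ^+ k * (cheb k).[x].
Proof.
elim/nat_ind2: k => [||k IH0 IH1]; first by rewrite !hornerC mul1r.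
  by rewrite !hornerX expr1 mulN1r.
by rewrite !horner_chebSS IH0 IH1 !exprS; ring.
Qed.

Lemma cheb_le1 k x : `|x| <= 1 -> `|(cheb k).[x]| <= 1.
Proof.
by rewrite ler_norml => x1; rewrite -(acosK x1) cheb_cos cos_max.
Qed.

Lemma cheb_at1 k : (cheb k).[1] = 1.
Proof. by rewrite -(cos0 R) cheb_cos mulr0. Qed.

(** The differences [d_k = T_(k+1) - T_k] satisfy [d_(k+1) = 2 (z - 1) T_(k+1) + d_k], so positivity
    and growth beyond 1 propagate together; hence the joint induction. *)
Lemma cheb_incr k x y : 1 <= x -> x < y ->
  [/\ 0 <= (cheb k.+1).[x] - (cheb k).[x],
   (cheb k.+1).[x] - (cheb k).[x] < (cheb k.+1).[y] - (cheb k).[y] &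
   [/\ 1 <= (cheb k).[x], (cheb k).[x] <= (cheb k).[y] & (cheb k.+1).[x] < (cheb k.+1).[y]]].
Proof.
move=> x1 xy; elim: k => [|k [d0 d1 [h1 h2 h3]]].
  by rewrite cheb1 cheb0 !hornerX !hornerC; split; [lra|lra|split; lra].
have e z : (cheb k.+2).[z] - (cheb k.+1).[z] =
    2 * (z - 1) * (cheb k.+1).[z] + ((cheb k.+1).[z] - (cheb k).[z]).
  by rewrite horner_chebSS; ring.
have p1 : 0 <= (x - 1) * (cheb k.+1).[x] by apply: mulr_ge0; lra.
have p2 : (x - 1) * (cheb k.+1).[x] <= (y - 1) * (cheb k.+1).[y].
  by apply: ler_pM; lra.
have e1 := e x; have e2 := e y.
by split; [lra|lra|split; lra].
Qed.

Lemma cheb_lt k x y : (0 < k)%N -> 1 <= x -> x < y -> (cheb k).[x] < (cheb k).[y].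
Proof. by case: k => // k _ x1 xy; have [_ _ []] := cheb_incr k x1 xy. Qed.

Lemma cheb_le k x y : 1 <= x -> x <= y -> (cheb k).[x] <= (cheb k).[y].
Proof.
move=> x1; rewrite le_eqVlt => /predU1P[->//|xy].
by have [_ _ []] := cheb_incr k x1 xy.
Qed.

Lemma cheb_gt1 k x : (0 < k)%N -> 1 < x -> 1 < (cheb k).[x].
Proof. by move=> k0 x1; rewrite -[ltLHS](cheb_at1 k) cheb_lt. Qed.

Lemma cos_node_lt k (i j : nat) : (i < j <= k)%N ->
  cos (j%:R * pi / k%:R) < cos (i%:R * pi / k%:R) :> R.
Proof.
move=> /andP[ij jk]; have k0 : (0 < k%:R :> R) by rewrite ltr0n (leq_ltn_trans _ (leq_trans ij jk)).
have pi0 := pi_gt0 R.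
have itv (l : nat) : (l <= k)%N -> l%:R * pi / k%:R \in `[0, pi : R]%R.
  move=> lk; rewrite in_itv/=; apply/andP; split.
    by rewrite divr_ge0// mulr_ge0// ltW.
  by rewrite ler_pdivrMr// mulrC ler_pM2l// ler_nat.
rewrite ltr_cos ?itv//; last by rewrite (leq_trans _ jk)// ltnW.
by rewrite ltr_pM2r ?invr_gt0// ltr_pM2r// ltr_nat.
Qed.

(** Both polynomials agree at the [k + 1] distinct points [cos (j pi / k)]. *)
Lemma is_chebyshevE k (T : {poly R}) : (0 < k)%N -> is_chebyshev k T -> T = cheb k.
Proof.
move=> k0 [sT hT]; pose u (j : 'I_k.+1) : R := cos (j%:R * pi / k%:R).
apply: (@poly_eq_at _ k _ _ u); rewrite ?sT ?size_cheb//.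
  move=> i j; rewrite /u => uij; apply/val_inj; move: (ltn_ord i) (ltn_ord j).
  rewrite !ltnS => ik jk; case: (ltngtP i j) => // h.
    by have := @cos_node_lt k i j; rewrite h jk uij ltxx => /(_ isT).
  by have := @cos_node_lt k j i; rewrite h ik uij ltxx => /(_ isT).
by move=> j; rewrite hT cheb_cos.
Qed.

(* [form k (chebf w c k) x = T_k (cos (x - w) / c)]: the recurrence of [T_k] made
   homogeneous by means of [sin ^ 2 + cos ^ 2 = 1]. *)
Fixpoint chebf2 (w c : R) k : {poly R} * {poly R} :=
  let l := c^-1 *: (cos w *: 'X + (sin w)%:P) in
  if k is k'.+1 then
    let: (T, U) := chebf2 w c k' in (U, 2%:R *: (l * U) - (1 + 'X^2) * T)
  else (1, l).

Definition chebf w c k := (chebf2 w c k).1.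

Lemma chebfSS w c k : chebf w c k.+2 =
  2%:R *: (chebf w c 1 * chebf w c k.+1) - (1 + 'X^2) * chebf w c k.
Proof. by rewrite /chebf /=; case: chebf2. Qed.

Lemma size_chebf1 w c : (size (chebf w c 1) <= 2)%N.
Proof.
rewrite /chebf/= (leq_trans (size_scale_leq _ _))//.
rewrite (leq_trans (size_polyD _ _))// geq_max (leq_trans (size_scale_leq _ _)) ?size_polyX//.
by rewrite (leq_trans (size_polyC_leq1 _)).
Qed.

Lemma size_chebf w c k : (size (chebf w c k) <= k.+1)%N.
Proof.
elim/nat_ind2: k => [||k IH0 IH1]; [by rewrite size_poly1|exact: size_chebf1|].
have sM (p r : {poly R}) a b : (size p <= a)%N -> (size r <= b.+1)%N ->
    (size (p * r)%R <= a + b)%N.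
  move=> pa rb; rewrite (leq_trans (size_polyMleq _ _))//.
  by rewrite -subn1 leq_subLR add1n -addnS leq_add.
rewrite chebfSS (leq_trans (size_polyD _ _))// size_polyN geq_max; apply/andP; split.
  by rewrite (leq_trans (size_scale_leq _ _))// (sM _ _ 2 k.+1)// size_chebf1.
apply: (sM _ _ 3 k) => //.
by rewrite (leq_trans (size_polyD _ _))// geq_max size_poly1 size_polyXn.
Qed.

(** Taking top coefficients turns the recurrence of [chebf] into that of [cheb], since [1 + 'X^2] is
    monic and the linear factor has leading coefficient [cos w / c]. *)
Lemma lead_chebf w c k : (chebf w c k)`_k = (cheb k).[cos w / c].
Proof.
elim/nat_ind2: k => [||k IH0 IH1]; first by rewrite hornerC coefC.
  by rewrite hornerX /chebf/= coefZ coefD coefZ coefX coefC/= mulr1 addr0 mulrC.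
rewrite horner_chebSS -IH0 -IH1 chebfSS coefB coefZ (mulrDl 1 'X^2) mul1r coefD.
rewrite coefXnM /= subn2/= (nth_default _ (_ : size (chebf w c k) <= k.+2)%N) ?add0r; last first.
  by rewrite (leq_trans (size_chebf _ _ _)).
congr (_ - _); rewrite -mulrA; congr (_ * _).
rewrite {1}/chebf/= -scalerAl coefZ mulrDl -scalerAl coefD coefZ coefXM/= coefCM.
rewrite (nth_default _ (_ : size (chebf w c k.+1) <= k.+2)%N) ?size_chebf//.
by rewrite mulr0 addr0; ring.
Qed.

Lemma form_chebf w c k x : 0 < x < pi -> form k (chebf w c k) x = (cheb k).[cos (x - w) / c].
Proof.
move=> x0; have s0 : sin x != 0 by rewrite gt_eqF// sin_gt0_pi.
rewrite form_cot ?size_chebf//.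
have l1 : sin x * (chebf w c 1).[cot x] = cos (x - w) / c.
  rewrite /chebf/= hornerZ hornerD hornerZ hornerX hornerC cosB /cot mulrC.
  by rewrite -[RHS]mulrC -mulrA; congr (_ * _); field.
elim/nat_ind2: k => [||k IH0 IH1]; first by rewrite expr0 mul1r !hornerC.
  by rewrite expr1 l1 hornerX.
have c2 : (1 + 'X^2).[cot x] = (sin x) ^- 2.
  by rewrite hornerD hornerXn hornerC cot2.
rewrite horner_chebSS -IH0 -IH1 -l1 chebfSS hornerD hornerN hornerZ.
rewrite (hornerM (chebf w c 1)) (hornerM (1 + 'X^2)) c2 !exprS.
by field.
Qed.

End chebyshev.

(** * Level sets of extremal forms *)

Section extremal.
Context {R : realType}.
Implicit Types (N : nat) (q : {poly R}) (x r : R).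

Lemma compact_lev N q r : r < `|q`_N| -> compact (lev N q r).
Proof.
move=> rq; have [d d0 Ed] := lev_away rq.
have -> : lev N q r = `[d, pi - d]%classic `&` (fun x => `|form N q x|) @^-1` [set y | y <= r].
  apply/seteqP; split => x; rewrite /= in_itv/=; first by move=> Ex; split; [exact: (Ed _ Ex)|case: Ex].
  by move=> [xd xr]; split => //; lra.
apply: compact_closedI; first exact: segment_compact.
apply: preimage_closed; last exact: closed_le.
by move=> x _; apply: continuous_comp; [exact: continuous_form|exact: norm_continuous].
Qed.

(** The maximum of the absolute value over [[a, b]] is interior; according to the sign there, it is
    a maximum or a minimum of the form itself. *)
Lemma critical_point N q a b x : (size q <= N.+1)%N -> 0 < a -> b < pi -> a < x < b ->
  `|form N q a| < `|form N q x| -> `|form N q b| < `|form N q x| ->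
  exists c, [/\ a < c < b, form N (dform N q) c = 0 & `|form N q x| <= `|form N q c|].
Proof.
move=> sq a0 bpi axb ax bx.
have ab : a <= b by lra.
have dc c : c \in `]a, b[%R -> is_derive c 1 (form N q) (form N (dform N q) c).
  by rewrite in_itv/= => cc; apply: is_derive_form => //; lra.
have [|c cab cmax] := @EVT_max R (fun x => `|form N q x|) a b ab.
  apply: continuous_subspaceT => t.
  by apply: continuous_comp; [exact: continuous_form|exact: norm_continuous].
have xc : `|form N q x| <= `|form N q c| by apply: cmax; rewrite in_itv/=; lra.
have cab' : a < c < b.
  move: cab; rewrite in_itv/= !le_eqVlt => /andP[/predU1P[ac|->] /predU1P[cb|->//]].
  - by move: ax; rewrite ac ltNge xc.
  - by move: ax; rewrite ac ltNge xc.
  - by move: bx; rewrite -cb ltNge xc.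
have cI : c \in `]a, b[%R by rewrite in_itv.
exists c; split=> //.
have cm t : t \in `]a, b[%R -> `|form N q t| <= `|form N q c|.
  by move=> tI; apply: cmax; move: tI; rewrite !in_itv/=; lra.
suff h : is_derive c 1 (form N q) 0.
  by rewrite -(@derive_val _ _ _ _ _ _ _ (dc _ cI)) (@derive_val _ _ _ _ _ _ _ h).
have dv t : t \in `]a, b[%R -> derivable (form N q) t 1.
  by move=> /dc[].
have [c0|c0] := leP 0 (form N q c).
  apply: (derive1_at_max ab dv cI) => t tI.
  by rewrite (le_trans (ler_norm _))// -[leRHS](ger0_norm c0) cm.
apply: (derive1_at_min ab dv cI) => t tI.
by rewrite -[leLHS]opprK -[- form N q c](ltr0_norm c0) lerNl (le_trans _ (cm _ tI))// ler_normr lexx orbT.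
Qed.

(* A level set with a gap away from 0 could be enlarged by [lev_perturb]. *)
Lemma maximizer_itv N q : (size q <= N.+1)%N -> 1 < `|q`_N| -> 0 < mlev N q 1 ->
  (forall p : {poly R}, (size p <= N.+1)%N -> p`_N = q`_N -> mlev N p 1 <= mlev N q 1) ->
  exists a b, [/\ 0 < a, a <= b, b < pi, lev N q 1 = `[a, b]%classic & mlev N q 1 = b - a].
Proof.
move=> sq qN m0 qmax.
have E0 : lev N q 1 !=set0.
  apply/set0P; apply/eqP => E0; move: m0.
  by rewrite /mlev E0 measure0 ltxx.
have cE := compact_lev qN.
have cid : {within lev N q 1, continuous (id : R -> R)}.
  by apply: continuous_subspaceT => x; exact: cvg_id.
have [a Ea amin] := compact_EVT_min E0 cE cid.
have [b Eb bmax] := compact_EVT_max E0 cE cid.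
have [a0 ha] := set_mem Ea; have [b0 hb] := set_mem Eb.
have ab : a <= b by exact: amin.
have EI : lev N q 1 = `[a, b]%classic.
  apply/seteqP; split=> x; rewrite /= in_itv/=.
    by move=> Ex; rewrite amin ?bmax ?inE.
  move=> axb; split; first lra.
  rewrite leNgt; apply/negP => x1.
  have ax : a < x.
    rewrite lt_neqAle; case/andP: axb => -> _; rewrite andbT.
    by apply: contraTneq x1 => <-; rewrite -leNgt.
  have bx : x < b.
    rewrite lt_neqAle; case/andP: axb => _ ->; rewrite andbT.
    by apply: contraTneq x1 => ->; rewrite -leNgt.
  have [|||||c [cab dc xc]] := @critical_point N q a b x sq; try lra.
  have [||p [sp pN mp]] := lev_perturb sq qN m0 _ dc _; try lra.
  by move: mp; rewrite ltNge qmax.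
exists a, b; split => //; try lra.
have := mlevE N q 1; rewrite EI lebesgue_measure_itv/= lte_fin.
by case: ltP => h [<-]//; lra.
Qed.

End extremal.

(** * The Remez inequality for forms *)

Section remez.
Context {R : realType}.
Implicit Types (N : nat) (q : {poly R}) (x r : R).

Lemma cos_natpi (k : nat) : cos (k%:R * pi) = (-1) ^+ k :> R.
Proof.
elim: k => [|k IH]; first by rewrite mul0r cos0.
by rewrite -addn1 natrD mulrDl mul1r cosDpi IH addn1 exprS mulN1r.
Qed.

Lemma ltr_acos (x y : R) : -1 <= x -> x < y -> y <= 1 -> acos y < acos x.
Proof.
move=> x1 xy y1.
have xI : x \in `[(-1), 1]%R by rewrite in_itv/=; lra.
have yI : y \in `[(-1), 1]%R by rewrite in_itv/=; lra.
have aI z : z \in `[(-1), 1]%R -> acos z \in `[0, pi]%R.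
  by rewrite !in_itv/= => z1; rewrite acos_ge0// acos_lepi.
by rewrite -ltr_cos ?aI// !acosK.
Qed.

Lemma ler_acos (x y : R) : -1 <= x -> x <= y -> y <= 1 -> acos y <= acos x.
Proof.
move=> x1; rewrite le_eqVlt => /predU1P[->//|xy] y1.
by rewrite ltW// ltr_acos.
Qed.

(** Here [w] is the offset of the midpoint of [[a, b]] from [pi / 2], and [c] is such that
    [cos (x - w) / c] runs from 1 to -1 on [[a, b]]. The comparison form therefore takes the values
    1 and -1 alternately at the [N + 1] points [X j]. *)
Lemma chebf_bound N q (a b : R) : (0 < N)%N -> (size q <= N.+1)%N ->
  0 < a -> a < b -> b < pi -> (forall x, a <= x <= b -> `|form N q x| <= 1) ->
  let w := (a + b - pi) / 2 in let c := cos ((pi - (b - a)) / 2) in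
  q`_N <= (cheb N).[cos w / c] /\ (q`_N = (cheb N).[cos w / c] -> q = chebf w c N).
Proof.
move=> N0 sq a0 ab bpi hq w c; rewrite -lead_chebf.
have pi0 := pi_gt0 R.
have c0 : 0 < c by apply: cos_gt0_pihalf; lra.
have c1 : c <= 1 by exact: cos_le1.
have NR : 0 < N%:R :> R by rewrite ltr0n.
pose th (j : nat) : R := cos (j%:R * pi / N%:R).
pose X (j : nat) := w + acos (c * th j).
have th1 j : -1 <= th j <= 1 by rewrite /th cos_geN1 cos_le1.
have cth j : - c <= c * th j <= c.
  by rewrite -{1}[c]mulr1 -mulrN -{4}[c]mulr1 !ler_pM2l.
have acosc : acos c = (pi - (b - a)) / 2.
  by rewrite /c cosK// in_itv/=; lra.
have Xab j : a <= X j <= b.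
  have /andP[h1 h2] := cth j.
  have A1 : acos c <= acos (c * th j) by apply: ler_acos; lra.
  have A2 : acos (c * th j) <= acos (- c) by apply: ler_acos; lra.
  move: A1 A2; rewrite acosN ?acosc /X /w; lra.
have X0 j : 0 < X j < pi by have := Xab j; lra.
have Xlt (i j : nat) : (i < j <= N)%N -> X i < X j.
  move=> ij; have tt : th j < th i by exact: cos_node_lt.
  rewrite ltrD2l ltr_acos//.
  - by have := cth j; lra.
  - by rewrite ltr_pM2l.
  - by have := cth i; lra.
have sX j : 0 < sin (X j) by apply: sin_gt0_pi.
have fX j : form N (chebf w c N) (X j) = (-1) ^+ j.
  rewrite form_chebf// /X addrAC subrr add0r acosK ?in_itv/=; last first.
    by have := cth j; lra.
  rewrite mulrAC divff ?gt_eqF// mul1r /th cheb_cos -cos_natpi; congr cos.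
  by field; rewrite gt_eqF.
(* Passing from forms to polynomials in [cot] divides the values by [sin ^ N], which becomes the
   amplitude. *)
apply: (@alternating_lead _ N (fun j => cot (X j)) (fun j => (sin (X j) ^+ N)^-1)) => //.
- move=> i j ij; apply: cot_lt.
  + by have /andP[] := X0 i.
  + by apply: Xlt; rewrite ij /= -ltnS ltn_ord.
  + by have /andP[] := X0 j.
- exact: size_chebf.
- move=> j; have := fX j; rewrite form_cot ?size_chebf// => <-.
  by field; rewrite gt_eqF// exprn_gt0.
- move=> j; have := hq _ (Xab j); rewrite form_cot// normrM.
  by rewrite gtr0_norm ?exprn_gt0// mulrC -ler_pdivlMr ?exprn_gt0// mul1r.
Qed.

Lemma remez_form N q (sg : R) : (0 < N)%N -> (size q <= N.+1)%N ->
  0 < sg < pi -> pi - sg <= mlev N q 1 ->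
  q`_N <= (cheb N).[(cos (sg / 2))^-1] /\
  (q`_N = (cheb N).[(cos (sg / 2))^-1] -> q = chebf 0 (cos (sg / 2)) N).
Proof.
move=> N0 sq sg0 hm.
have pi0 := pi_gt0 R.
have cbd (s : R) : 0 < s < pi -> 0 < cos (s / 2) < 1.
  move=> s0; rewrite cos_gt0_pihalf/=; last lra.
  by rewrite -[ltRHS]cos0 ltr_cos ?in_itv/=; lra.
have c0 := cbd _ sg0.
have ci1 : 1 < (cos (sg / 2))^-1 by rewrite invf_gt1; lra.
have C1 := cheb_gt1 N0 ci1.
have [q1|q1] := leP q`_N 1.
  by split; [lra|move=> qE; move: C1; rewrite -qE ltNge q1].
have qN : 1 < `|q`_N| by rewrite (lt_le_trans q1)// ler_norm.
have m0 : 0 < mlev N q 1 by lra.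
(* This is stated for any maximizer because it serves twice: for one given by compactness and, in
   the case of equality, for [q] itself. *)
have itv_bound (p : {poly R}) : (size p <= N.+1)%N -> p`_N = q`_N -> pi - sg <= mlev N p 1 ->
    (forall p' : {poly R}, (size p' <= N.+1)%N -> p'`_N = q`_N -> mlev N p' 1 <= mlev N p 1) ->
    q`_N <= (cheb N).[(cos (sg / 2))^-1] /\
    (q`_N = (cheb N).[(cos (sg / 2))^-1] ->
       mlev N p 1 = pi - sg /\ p = chebf 0 (cos (sg / 2)) N).
  move=> sp pN pm pmax.
  have [||||a [b [a0 ab bpi pE pab]]] := @maximizer_itv _ N p; rewrite ?pN//; first lra.
  have ab' : a < b by lra.
  have pb x : a <= x <= b -> `|form N p x| <= 1.
    move=> xab; have : lev N p 1 x by rewrite pE /= in_itv.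
    by case.
  have [] := chebf_bound N0 sp a0 ab' bpi pb; rewrite pN.
  set w := (a + b - pi) / 2; set s := pi - (b - a) => h1 h2.
  have s0 : 0 < s < pi by rewrite /s; lra.
  have ssg : s <= sg by rewrite /s; lra.
  have cs := cbd _ s0.
  have cc : cos (sg / 2) <= cos (s / 2).
    by rewrite leNgt ltr_cos ?in_itv/= -?leNgt; lra.
  have w0 : cos w <= 1 by exact: cos_le1.
  (* Since [[a, b]] lies inside []0, pi[], the offset is less than [s / 2]; the argument of [cheb N]
     is thus at least 1, where it increases. *)
  have ws : - (s / 2) < w < s / 2 by rewrite /s /w; lra.
  have csw : cos (s / 2) <= cos w.
    rewrite -(cos_norm w) leNgt ltr_cos ?in_itv/= -?leNgt ?normr_ge0/=; try lra.
      by rewrite ler_norml; lra.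
    by rewrite ler_norml; lra.
  have z1 : 1 <= cos w / cos (s / 2) by rewrite ler_pdivlMr; lra.
  have z2 : cos w / cos (s / 2) <= (cos (s / 2))^-1.
    by rewrite ler_pdivrMr ?mulVf ?gt_eqF; lra.
  have z3 : (cos (s / 2))^-1 <= (cos (sg / 2))^-1.
    by rewrite lef_pV2 ?posrE; lra.
  have k1 := cheb_le N z1 z2.
  have k2 := cheb_le N (le_trans z1 z2) z3.
  split; first lra.
  move=> qE.
  (* Strict monotonicity turns both inequalities of the chain into equalities, giving [s = sg] and
     [w = 0]. *)
  have e2 : (cos (s / 2))^-1 = (cos (sg / 2))^-1.
    apply/eqP; rewrite eq_le z3 leNgt; apply/negP => lt.
    have := cheb_lt N0 (le_trans z1 z2) lt; lra.
  have e1 : cos w / cos (s / 2) = (cos (s / 2))^-1.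
    apply/eqP; rewrite eq_le z2 leNgt; apply/negP => lt.
    have := cheb_lt N0 z1 lt; have := congr1 (horner (cheb N)) e2; lra.
  have {}e2 : s = sg.
    have I1 : s / 2 \in `[0, pi]%R by rewrite in_itv/=; lra.
    have I2 : sg / 2 \in `[0, pi]%R by rewrite in_itv/=; lra.
    have := cos_inj I1 I2 (invr_inj e2); lra.
  have cw1 : cos w = 1.
    by move: e1 => /(congr1 (fun z => z * cos (s / 2))); rewrite divfK ?mulVf ?gt_eqF//; lra.
  have wE : w = 0.
    apply/eqP; rewrite -normr_eq0; apply/eqP.
    apply: cos_inj; rewrite ?in_itv/= ?normr_ge0 ?ler_norml ?cos_norm ?cos0//; lra.
  split; first by rewrite pab; rewrite /s in e2; lra.
  by rewrite h2; [rewrite wE e2|rewrite qE cw1 mul1r e2].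
have [p [sp pN pmax]] := mlev_maximizer sq m0.
have pm : pi - sg <= mlev N p 1 by rewrite (le_trans hm)// pmax.
have [h1 h2] := itv_bound p sp pN pm pmax.
(* The maximal measure is now [pi - sg], which [q] reaches by hypothesis, so [q] is a maximizer
   too. *)
split=> // qE; have [mp _] := h2 qE.
have [] := itv_bound q sq erefl hm _.
  move=> p' sp' p'N; rewrite (le_trans (pmax _ sp' p'N))// mp//.
by move=> _ /(_ qE)[].
Qed.

End remez.

(** * Trigonometric polynomials as forms *)

Section trig.
Context {R : realType}.
Implicit Types (N n k : nat) (x t : R) (a b : nat -> R).

Definition rtrig n a b t : R :=
  a 0%N + \sum_(1 <= k < n.+1) (a k * cos (k%:R * t) + b k * sin (k%:R * t)).

Lemma rtrigDr n a b d : exists a' b', forall t, rtrig n a b (t + d) = rtrig n a' b' t.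
Proof.
exists (fun k => a k * cos (k%:R * d) + b k * sin (k%:R * d)).
exists (fun k => b k * cos (k%:R * d) - a k * sin (k%:R * d)) => t.
rewrite /rtrig mul0r cos0 sin0 mulr1 mulr0 addr0; congr (_ + _).
by apply: eq_bigr => k _; rewrite mulrDr cosD sinD; ring.
Qed.

Lemma rtrig_periodic n a b t : rtrig n a b (t + 2 * pi) = rtrig n a b t.
Proof.
congr (_ + _); apply: eq_bigr => k _.
have -> : k%:R * (t + 2 * pi) = k%:R * t + (pi *+ 2) *+ k by rewrite -[(pi *+ 2) *+ k]mulr_natr -[pi *+ 2]mulr_natr; ring.
by rewrite (periodicn (@cosD2pi R)) (periodicn (@sinD2pi R)).
Qed.

Lemma continuous_rtrig n a b : continuous (rtrig n a b).
Proof.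
move=> t.
have cM (c d : R) (f : R -> R) : continuous f -> continuous (fun t => c * f (d * t)).
  move=> cf u; apply: cvgM; first exact: cvg_cst.
  by apply: (@continuous_comp _ _ _ (fun u => d * u) f); [exact: mulrl_continuous|exact: cf].
rewrite (_ : rtrig n a b = cst (a 0%N) + \sum_(1 <= k < n.+1)
   ((fun t => a k * cos (k%:R * t)) + (fun t => b k * sin (k%:R * t)))); last first.
  by apply/funext => u; rewrite /rtrig fctE fct_sumE.
apply: continuousD; first exact: cvg_cst.
apply: big_ind => [|f g cf cg|k _]; [exact: cvg_cst|exact: continuousD|].
by apply: continuousD; apply: cM; [exact: continuous_cos|exact: continuous_sin].
Qed.

(** The number [v] is the value of the form at 0, recorded as a coefficient because [cot] is only
    usable inside []0, pi[]. *)
Definition formed N (g : R -> R) (v : R) := exists q : {poly R},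
  [/\ (size q <= N.+1)%N, q`_N = v & forall x, 0 < x < pi -> g x = form N q x].

Lemma formedD N g h v w : formed N g v -> formed N h w ->
  formed N (fun x => g x + h x) (v + w).
Proof.
move=> [p [sp pN gp]] [q [sq qN hq]]; exists (p + q); split.
- by rewrite (leq_trans (size_polyD _ _))// geq_max sp.
- by rewrite coefD pN qN.
- by move=> x x0; rewrite formD gp// hq.
Qed.

Lemma formedZ N (c : R) g v : formed N g v -> formed N (fun x => c * g x) (c * v).
Proof.
move=> [p [sp pN gp]]; exists (c *: p); split.
- by rewrite (leq_trans (size_scale_leq _ _)).
- by rewrite coefZ pN.
- by move=> x x0; rewrite formZ gp.
Qed.

Lemma formedM N M g h v w : formed N g v -> formed M h w ->
  formed (N + M) (fun x => g x * h x) (v * w).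
Proof.
move=> [p [sp pN gp]] [q [sq qN hq]].
have spq : (size (p * q)%R <= (N + M).+1)%N.
  rewrite (leq_trans (size_polyMleq _ _))// -subn1 leq_subLR add1n.
  by rewrite -addSn -addnS leq_add.
exists (p * q); split => //.
  have NL : (N < (N + M).+1)%N by rewrite ltnS leq_addr.
  rewrite coefM (bigD1 (Ordinal NL))//= addKn pN qN big1 ?addr0// => i iN.
  have [lt|gt|e] := ltngtP i N.
  - by rewrite (nth_default _ (_ : size q <= N + M - i)%N) ?mulr0// (leq_trans sq)//; lia.
  - by rewrite (nth_default _ (_ : size p <= i)%N) ?mul0r// (leq_trans sp).
  - by move: iN; rewrite -val_eqE/= e eqxx.
by move=> x x0; rewrite gp// hq// !form_cot// hornerM exprD; ring.
Qed.

Lemma formed_ext N g h v : g =1 h -> formed N g v -> formed N h v.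
Proof.
by move=> gh [q [sq qN gq]]; exists q; split => // x x0; rewrite -gh gq.
Qed.

Lemma formed_cos2 : formed 2 (fun x => cos (2 * x)) 1.
Proof.
exists ('X^2 - 1); split.
- by rewrite size_XnsubC.
- by rewrite coefB coefXn coefC/= subr0.
move=> x x0; have s0 : sin x != 0 by rewrite gt_eqF// sin_gt0_pi.
rewrite form_cot ?size_XnsubC// hornerD hornerN hornerXn hornerC.
rewrite mulr_natl cos_mulr2n (_ : sin x ^+ 2 * _ = cos x ^+ 2 - sin x ^+ 2).
  by rewrite sin2cos2; ring.
by rewrite /cot; field.
Qed.

Lemma formed_sin2 : formed 2 (fun x => sin (2 * x)) 0.
Proof.
have s2 : (size (2%:R *: 'X : {poly R}) <= 3)%N.
  by rewrite (leq_trans (size_scale_leq _ _))// size_polyX.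
exists (2%:R *: 'X); split => //.
- by rewrite coefZ coefX mulr0.
move=> x x0; have s0 : sin x != 0 by rewrite gt_eqF// sin_gt0_pi.
rewrite form_cot// hornerZ hornerX mulr_natl sin_mulr2n /cot; by field.
Qed.

(** The constant is a power of [sin ^ 2 + cos ^ 2]; multiplying by it brings terms of lower
    frequency to the common order [2 * n]. *)
Lemma formed1 k : formed (2 * k) (fun=> 1) 1.
Proof.
elim: k => [|k IH].
  exists 1; split; rewrite ?size_poly1 ?coefC//.
  by move=> x x0; rewrite form_cot ?size_poly1// hornerC mul1r.
have : formed 2 (fun=> 1) 1.
  have s2 : (size (1 + 'X^2 : {poly R})%R <= 3)%N.
    by rewrite (leq_trans (size_polyD _ _))// geq_max size_poly1 size_polyXn.
  exists (1 + 'X^2 : {poly R}); split => //.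
    by rewrite coefD coefXn coefC/= add0r.
  move=> x x0; have s0 : sin x != 0 by rewrite gt_eqF// sin_gt0_pi.
  by rewrite form_cot// hornerD hornerXn hornerC cot2// divff ?expf_neq0.
by move=> /(formedM IH); rewrite mulr1 mulnS addnC.
Qed.

Lemma formed_cos_sin k : formed (2 * k) (fun x => cos (k%:R * (2 * x))) 1 /\
  formed (2 * k) (fun x => sin (k%:R * (2 * x))) 0.
Proof.
elim: k => [|k [IHc IHs]].
  split; first by apply: formed_ext (formed1 0) => x; rewrite mul0r cos0.
  have := formedZ 0 (formed1 0); rewrite mul0r; apply: formed_ext => x.
  by rewrite !mul0r sin0.
have kS x : k.+1%:R * (2 * x) = k%:R * (2 * x) + 2 * x by rewrite -natr1; ring.
rewrite mulnS addnC; split.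
  have := formedD (formedM IHc formed_cos2) (formedZ (-1) (formedM IHs formed_sin2)).
  rewrite !mul1r !mulr0 addr0; apply: formed_ext => x.
  by rewrite kS cosD mulN1r.
have := formedD (formedM IHs formed_cos2) (formedM IHc formed_sin2).
by rewrite mul0r mulr0 addr0; apply: formed_ext => x; rewrite kS sinD.
Qed.

Lemma formed_sum N (r : seq nat) (P : pred nat) (g : nat -> R -> R) (v : nat -> R) :
  (forall k, P k -> formed N (g k) (v k)) ->
  formed N (fun x => \sum_(k <- r | P k) g k x) (\sum_(k <- r | P k) v k).
Proof.
move=> gv; elim: r => [|k r IH].
  exists 0; split; rewrite ?size_poly0 ?coef0 ?big_nil//.
  by move=> x x0; rewrite big_nil form_cot ?size_poly0// horner0 mulr0.
rewrite big_cons; case: ifPn => Pk; last first.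
  by apply: formed_ext IH => x; rewrite big_cons (negbTE Pk).
by apply: formed_ext (formedD (gv _ Pk) IH) => x; rewrite big_cons Pk.
Qed.

Lemma formed_rtrig0 n a b : formed (2 * n) (fun x => rtrig n a b (2 * x)) (rtrig n a b 0).
Proof.
rewrite /rtrig; apply: formedD.
  by have := formedZ (a 0%N) (formed1 n); rewrite mulr1.
rewrite big_nat; apply: formed_ext (formed_sum (index_iota 1 n.+1) _) => [x|k /andP[_ kn]].
  by rewrite [RHS]big_nat.
have [fc fs] := formed_cos_sin k.
have f1 := formed1 (n - k).
have e : (2 * k + 2 * (n - k) = 2 * n)%N by rewrite -mulnDr subnKC.
have := formedD (formedZ (a k) (formedM fc f1)) (formedZ (b k) (formedM fs f1)).
rewrite e !mulr0 cos0 sin0 !mulr1 !mulr0; apply: formed_ext => x.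
by rewrite !mulr1.
Qed.

Lemma formed_rtrig n a b t0 :
  formed (2 * n) (fun x => rtrig n a b (t0 + 2 * x)) (rtrig n a b t0).
Proof.
have [a' [b' E]] := rtrigDr n a b t0.
have := formed_rtrig0 n a' b'; rewrite -E add0r; apply: formed_ext => x.
by rewrite -E addrC.
Qed.

End trig.

(** * Complex trigonometric polynomials *)

Section complex_trig.
Context {R : realType}.
Implicit Types (n : nat) (t : R) (z w : R[i]).
Local Notation normc := ComplexField.Normc.normc.

(** Real and imaginary parts are both instances of such a real-linear [L]. *)
Lemma trig_sum_part (L : R[i] -> R) n (a b : nat -> R[i]) c t :
  L 0 = 0 -> {morph L : z w / z + w} -> (forall z (r : R), L (z * r%:C) = L z * r) ->
  L (c * trig_sum n a b t) = rtrig n (fun k => L (c * a k)) (fun k => L (c * b k)) t.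
Proof.
move=> L0 LD LZ; rewrite /trig_sum mulrDr LD; congr (_ + _).
rewrite mulr_sumr (big_morph _ LD L0); apply: eq_bigr => k _.
by rewrite mulrDr LD !mulrA !LZ.
Qed.

Lemma Re_trig_sum n (a b : nat -> R[i]) c t : complex.Re (c * trig_sum n a b t) =
  rtrig n (fun k => complex.Re (c * a k)) (fun k => complex.Re (c * b k)) t.
Proof.
by apply: trig_sum_part => // [[? ?] [? ?]//|[x y] r] /=; ring.
Qed.

Lemma Im_trig_sum n (a b : nat -> R[i]) c t : complex.Im (c * trig_sum n a b t) =
  rtrig n (fun k => complex.Im (c * a k)) (fun k => complex.Im (c * b k)) t.
Proof.
by apply: trig_sum_part => // [[? ?] [? ?]//|[x y] r] /=; ring.
Qed.

Lemma trig_sum_real n (a b : nat -> R) t :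
  trig_sum n (fun k => (a k)%:C) (fun k => (b k)%:C) t = (rtrig n a b t)%:C.
Proof.
rewrite /trig_sum /rtrig rmorphD rmorph_sum; congr (_ + _); apply: eq_bigr => k _.
by rewrite rmorphD !rmorphM.
Qed.

Lemma normcE z : normc z = Num.sqrt (complex.Re z ^+ 2 + complex.Im z ^+ 2).
Proof. by case: z. Qed.

Lemma normc_real (r : R) : normc r%:C = `|r|.
Proof. by rewrite normcE /= expr0n addr0 sqrtr_sqr. Qed.

Lemma Re_le_normc z : `|complex.Re z| <= normc z.
Proof. by rewrite normcE -sqrtr_sqr ler_wsqrtr// lerDl sqr_ge0. Qed.

Lemma normc_trig_sum_continuous n (a b : nat -> R[i]) :
  continuous (fun t => normc (trig_sum n a b t)).
Proof.
pose f := rtrig n (fun k => complex.Re (1 * a k)) (fun k => complex.Re (1 * b k)).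
pose g := rtrig n (fun k => complex.Im (1 * a k)) (fun k => complex.Im (1 * b k)).
have -> : (fun t => normc (trig_sum n a b t)) = Num.sqrt \o (fun t => f t * f t + g t * g t).
  by apply/funext => t /=; rewrite normcE -[trig_sum n a b t]mul1r Re_trig_sum Im_trig_sum !expr2.
move=> t; apply: continuous_comp; last exact: sqrt_continuous.
have cf : f @ t --> f t by exact: continuous_rtrig.
have cg : g @ t --> g t by exact: continuous_rtrig.
exact: (cvgD (cvgM cf cf) (cvgM cg cg)).
Qed.

Lemma trig_sum_periodic n (a b : nat -> R[i]) t :
  trig_sum n a b (t + 2 * pi) = trig_sum n a b t.
Proof.
apply/eqP; rewrite eq_complex -[X in complex.Re X]mul1r -[X in _ == complex.Re X]mul1r.
rewrite -[X in complex.Im X]mul1r -[X in _ == complex.Im X]mul1r.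
by rewrite !Re_trig_sum !Im_trig_sum !rtrig_periodic !eqxx.
Qed.

Lemma periodicz (V : Type) (h : R -> V) (T : R) (k : int) t :
  (forall t, h (t + T) = h t) -> h (t + T * k%:~R) = h t.
Proof.
move=> hT; have nat_case (m : nat) u : h (u + T * m%:R) = h u.
  elim: m u => [|m IH] u; first by rewrite mulr0 addr0.
  by rewrite -natr1 mulrDr mulr1 addrA hT IH.
case: k => m; first exact: nat_case.
by rewrite NegzE mulrNz mulrN -(nat_case m.+1) subrK.
Qed.

(** The representative is chosen before [V] and [h], so that it serves several periodic functions at
    once. *)
Lemma period_repr t : exists2 t' : R, 0 <= t' < 2 * pi &
  forall (V : Type) (h : R -> V), (forall t, h (t + 2 * pi) = h t) -> h t = h t'.
Proof.
have pi0 := pi_gt0 R; have p2 : 0 < 2 * pi :> R by lra.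
set k := Num.floor (t / (2 * pi)).
have /andP[k1 k2] := floor_itv (t / (2 * pi)).
rewrite -/k in k1 k2; rewrite ler_pdivlMr// in k1.
rewrite ltr_pdivrMr// rmorphD/= mulrDl mul1r in k2.
exists (t - 2 * pi * k%:~R); first by rewrite [2 * pi * _]mulrC; lra.
by move=> V h hT; rewrite -(periodicz k (t - 2 * pi * k%:~R) hT) subrK.
Qed.

End complex_trig.

(** * Transfer of measure from the circle to the half-angle variable *)

Section measure_conv.
Context {R : realType}.
Let mu := (@lebesgue_measure R).

Lemma measurable_sublevel (h : R -> R) (b1 b2 : bool) (u v : R) : continuous h ->
  measurable ([set` Interval (BSide b1 u) (BSide b2 v)] `&` [set t | h t <= 1]).
Proof.
move=> ch; apply: measurableI; first exact: measurable_itv.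
apply: measurable_realfun.closed_measurable.
apply: (@preimage_closed R R h [set y | y <= 1]); last exact: closed_le.
by move=> x _; exact: ch.
Qed.

(** Cut the circle at [t0], which is outside the level set, and halve the angle. The resulting [f]
    contracts exactly by 2 on each side of the cut, with images separated by [pi - t0 / 2]. *)
Lemma halfperiod_measure (h : R -> R) (t0 s : R) : continuous h ->
  (forall t, h (t + 2 * pi) = h t) -> 0 <= t0 < 2 * pi -> 1 < h t0 ->
  ((2 * pi - s)%:E <= mu [set t | (0 <= t < 2 * pi)%R /\ (h t <= 1)%R])%E ->
  ((pi - s / 2)%:E <= mu [set x | (0 < x < pi)%R /\ (h (t0 + 2 * x) <= 1)%R])%E.
Proof.
move=> ch hT t00 h1; set A := mkset _; set B := mkset _ => hm.
have pi0 := pi_gt0 R.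
have AE : A = `[0, 2 * pi[%classic `&` [set t | h t <= 1].
  by apply/seteqP; split => t; rewrite /A /= in_itv.
have BE : B = `]0, pi[%classic `&` [set t | h (t0 + 2 * t) <= 1].
  by apply/seteqP; split => t; rewrite /B /= in_itv.
have mA : measurable A by rewrite AE; exact: measurable_sublevel.
have mB : measurable B.
  rewrite BE; apply: (@measurable_sublevel (fun x => h (t0 + 2 * x))) => x.
  have cf : t0 + 2 * y @[y --> x] --> t0 + 2 * x.
    by apply: cvgD; [exact: cvg_cst|exact: mulrl_continuous].
  exact: (cvg_comp _ _ cf (ch _)).
pose f t := if t0 < t then (t - t0) / 2 else (t - t0) / 2 + pi.
have fE t : h (t0 + 2 * f t) = h t.
  rewrite /f; case: ifP => _.
    by rewrite (_ : _ + _ = t)//; field.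
  by rewrite -(hT t) (_ : t0 + _ = t + 2 * pi)//; field.
have At0 t : A t -> t != t0.
  by move=> [_ ht]; apply: contraTneq h1 => <-; rewrite -leNgt.
have : (mu A <= 2%:E * mu B)%E.
  apply: (@split_expanding _ A B `]t0, +oo[ `]-oo, (pi - t0 / 2)%R[ f) => //.
  - move=> t At; have [tb ht] := At; split; last by rewrite fE.
    rewrite /f; case: (ltP t0 t) => tt0; first lra.
    by have tlt : t < t0; [rewrite lt_neqAle At0|lra].
  - move=> t [tb _]; rewrite /= !in_itv/= andbT /f.
    by case: (ltP t0 t) => tt0; split => // h2; lra.
  - move=> x y Ax Ay; rewrite /= !in_itv/= !andbT => xy.
    have {}xy : (t0 < x) = (t0 < y) by apply/idP/idP; case: xy.
    rewrite /f xy; case: ifP => _.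
      rewrite (_ : (x - t0) / 2 - (y - t0) / 2 = (x - y) / 2); last by field.
      by rewrite normrM (@ger0_norm _ (2^-1)) ?invr_ge0//; lra.
    rewrite (_ : (x - t0) / 2 + pi - ((y - t0) / 2 + pi) = (x - y) / 2); last by field.
    by rewrite normrM (@ger0_norm _ (2^-1)) ?invr_ge0//; lra.
move=> /(le_trans hm).
have Bfin : mu B \is a fin_num.
  rewrite ge0_fin_numE ?measure_ge0//.
  apply: (@le_lt_trans _ _ (pi : R)%:E); last exact: ltry.
  by apply: lebesgue_measure_diam; [exact: pi_ge0|move=> x y [x0 _] [y0 _]; lra].
rewrite -(fineK Bfin) -EFinM !lee_fin; lra.
Qed.

(** A set missing a neighbourhood of a point of [[a, b]] misses a nonempty open subinterval and
    loses its length. *)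
Lemma full_measure_itv (A : set R) (a b x : R) : a < b -> A `<=` `[a, b]%classic ->
  ((b - a)%:E <= mu A)%E -> a <= x <= b -> (\forall y \near x, ~ A y) -> False.
Proof.
move=> ab Aab mA xab /nbhs_ballP[e /= e0 hA].
(* The gap is taken to the right of [x], except when [x = b]. *)
have [c [d [cd ac db Acd]]] : exists c d, [/\ c < d, a <= c, d <= b &
    forall y, c < y < d -> ~ A y].
  have [xb|bx] := ltP x b.
    exists x, (Num.min b (x + e)); split; [|lra| |].
    - by rewrite lt_min xb ltrDl.
    - by rewrite ge_min lexx.
    - move=> y; rewrite lt_min => yb; apply: hA.
      by rewrite /ball/= ltr0_norm; lra.
  exists (Num.max a (x - e)), x; split; [| |lra|].
  - by rewrite gt_max; lra.
  - by rewrite le_max lexx.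
  - move=> y; rewrite gt_max => yb; apply: hA.
    by rewrite /ball/= gtr0_norm; lra.
have sub : A `<=` `[a, c]%classic `|` `[d, b]%classic.
  move=> y Ay; have := Aab _ Ay; rewrite /= !in_itv/= => yab.
  have := Acd y; have [cy|yc] := ltP c y; last by move=> _; left; lra.
  have [yd|dy] := ltP y d; first by move=> /(_ isT).
  by move=> _; right; lra.
have : (mu A <= (c - a)%:E + (b - d)%:E)%E.
  apply: (@le_trans _ _ (mu (`[a, c]%classic `|` `[d, b]%classic))).
    exact: le_outer_measure.
  apply: (@le_trans _ _ (mu `[a, c]%classic + mu `[d, b]%classic)%E).
    by apply: measureU2; exact: measurable_itv.
  rewrite /mu !lebesgue_measure_itv/= !lte_fin.
  by apply: leeD; case: ltP => h; rewrite -?EFinB lee_fin; lra.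
by move=> /(le_trans mA); rewrite -EFinD lee_fin; lra.
Qed.

End measure_conv.

(** * The inequality at one point of the circle and its case of equality *)

Section core.
Context {R : realType}.
Implicit Types (n : nat) (x t : R).
Let mu := (@lebesgue_measure R).
Local Notation normc := ComplexField.Normc.normc.

Lemma norm_cos_le (al x : R) : 0 <= al <= pi / 2 -> 0 <= x <= pi ->
  (`|cos x| <= cos al) = (al <= x <= pi - al).
Proof.
move=> al0 x0; have pi0 := pi_gt0 R.
have -> : cos al = - cos (pi - al) by rewrite cosB cospi sinpi; ring.
rewrite ler_norml opprK andbC -[in X in _ <= X](opprK (cos _)).
have -> : - cos (pi - al) = cos al by rewrite cosB cospi sinpi; ring.
by rewrite opprK !(leNgt (cos _)) !ltr_cos ?in_itv/= -?leNgt//; lra.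
Qed.

Lemma cheb2_norm n x : (cheb (2 * n)).[`|x|] = (cheb (2 * n)).[x].
Proof.
have [x0|x0] := ger0P x; first by [].
by rewrite chebN exprM sqrrN expr1n expr1n mul1r.
Qed.

Lemma cheb2_le1 n x : (0 < n)%N -> (`|(cheb (2 * n)).[x]| <= 1) = (`|x| <= 1).
Proof.
move=> n0; apply/idP/idP => [|/cheb_le1//].
apply: contraTT; rewrite -!ltNge -(cheb2_norm n x) => x1.
by rewrite (lt_le_trans _ (ler_norm _))// cheb_gt1// muln_gt0.
Qed.

(** The polynomial is even, bounded by 1 on [[-1, 1]] and strictly increasing beyond 1. *)
Lemma cheb2_inj_at n x y : (0 < n)%N -> 1 <= x -> `|y| <= x ->
  1 < x -> (cheb (2 * n)).[y] = (cheb (2 * n)).[x] -> `|y| = x.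
Proof.
move=> n0 x1 yx x1' e.
have N0 : (0 < 2 * n)%N by rewrite muln_gt0.
have [y1|y1] := leP `|y| 1.
  have := cheb_gt1 N0 x1'; rewrite -e => h.
  by have := cheb2_le1 y n0; rewrite y1 leNgt (lt_le_trans h (ler_norm _)).
move: yx; rewrite le_eqVlt => /predU1P[//|lt].
by have := cheb_lt N0 (ltW y1) lt; rewrite cheb2_norm e ltxx.
Qed.

Lemma remez_trig n (s t0 : R) (a b : nat -> R[i]) : (0 < n)%N -> 0 < s < 2 * pi ->
  0 <= t0 < 2 * pi -> 1 < normc (trig_sum n a b t0) ->
  ((2 * pi - s)%:E <= mu (sublevel (trig_sum n a b)))%E ->
  normc (trig_sum n a b t0) <= (cheb (2 * n)).[(cos (s / 4))^-1] /\
  (normc (trig_sum n a b t0) = (cheb (2 * n)).[(cos (s / 4))^-1] ->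
   exists2 c : R[i], normc c = 1 &
     forall t, c * trig_sum n a b t = ((cheb (2 * n)).[cos ((t - t0) / 2) / cos (s / 4)])%:C).
Proof.
move=> n0 s0 t00; set Q := trig_sum n a b; set M := normc (Q t0) => M1 mQ.
have pi0 := pi_gt0 R.
set N := (2 * n)%N; have N0 : (0 < N)%N by rewrite muln_gt0.
have Q0 : Q t0 != 0.
  by apply: contraTneq M1 => Q0; rewrite /M Q0 ComplexField.Normc.normc0 -leNgt.
(* This unimodular constant makes the value at [t0] equal to its modulus [M]. *)
pose c := M%:C / Q t0.
have cQ0 : c * Q t0 = M%:C by rewrite /c divfK.
have c1 : normc c = 1.
  rewrite /c ComplexField.Normc.normcM ComplexField.Normc.normcV normc_real.
  by rewrite gtr0_norm ?(lt_trans _ M1)// divff// gt_eqF// (lt_trans _ M1).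
have QT t : Q (t + 2 * pi) = Q t by exact: trig_sum_periodic.
have cn : continuous (fun t => normc (Q t)) by exact: normc_trig_sum_continuous.
set B := [set x : R | 0 < x < pi /\ normc (Q (t0 + 2 * x)) <= 1].
have mB : ((pi - s / 2)%:E <= mu B)%E.
  apply: (@halfperiod_measure _ (fun t => normc (Q t)) t0 s) => //.
  by move=> t; rewrite QT.
have [q [sq qN qE]] := formed_rtrig n (fun k => complex.Re (c * a k)) (fun k => complex.Re (c * b k)) t0.
have {}qE x : 0 < x < pi -> form N q x = complex.Re (c * Q (t0 + 2 * x)).
  by move=> /qE <-; rewrite Re_trig_sum.
have {}qN : q`_N = M by rewrite qN -Re_trig_sum -/Q cQ0.
have Blev : B `<=` lev N q 1.
  move=> x [x0 xQ]; split=> //; rewrite qE// (le_trans (Re_le_normc _))//.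
  by rewrite ComplexField.Normc.normcM c1 mul1r.
have mq : pi - s / 2 <= mlev N q 1.
  rewrite -lee_fin -mlevE; apply: le_trans mB _.
  exact: le_outer_measure.
have sg0 : 0 < s / 2 < pi by lra.
have := remez_form N0 sq sg0 mq; rewrite qN (_ : s / 2 / 2 = s / 4); last by field.
move=> [h1 h2]; split=> // ME; have {}h2 := h2 ME.
set ka := cos (s / 4) in h2 ME *.
have ka0 : 0 < ka by apply: cos_gt0_pihalf; lra.
have ka1 : ka < 1 by rewrite -[ltRHS]cos0 ltr_cos ?in_itv/=; lra.
have ReE x : 0 < x < pi -> complex.Re (c * Q (t0 + 2 * x)) = (cheb N).[cos x / ka].
  by move=> x0; rewrite -qE// h2 form_chebf// subr0.
have BI x : B x -> s / 4 <= x <= pi - s / 4.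
  move=> Bx; have [x0 _] := Bx; have [_] := Blev _ Bx.
  rewrite qE// ReE// cheb2_le1// normrM [X in _ * X]gtr0_norm ?invr_gt0//.
  by rewrite ler_pdivrMr// mul1r norm_cos_le//; lra.
(* The set [B] lies in this interval and has at least its measure, while the condition [|Q| > 1] is
   open; so it can hold nowhere there. *)
have QI x : s / 4 <= x <= pi - s / 4 -> normc (c * Q (t0 + 2 * x)) <= 1.
  move=> xI; rewrite ComplexField.Normc.normcM c1 mul1r leNgt; apply/negP => Qx.
  apply: (@full_measure_itv _ B (s / 4) (pi - s / 4) x _ _ _ xI); first lra.
  - by move=> y /BI; rewrite /= in_itv.
  - by apply: le_trans mB; rewrite lee_fin; lra.
  have cf : t0 + 2 * y @[y --> x] --> t0 + 2 * x.
    by apply: cvgD; [exact: cvg_cst|exact: mulrl_continuous].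
  have cg : normc (Q (t0 + 2 * y)) @[y --> x] --> normc (Q (t0 + 2 * x)).
    exact: (cvg_comp _ _ cf (cn _)).
  have : \forall y \near x, 1 < normc (Q (t0 + 2 * y)) by apply: (cvgr_gt _ cg).
  apply: filterS => y Qy [_].
  by rewrite leNgt Qy.
have [p [sp pN pE]] := formed_rtrig n (fun k => complex.Im (c * a k)) (fun k => complex.Im (c * b k)) t0.
have {}pE x : 0 < x < pi -> form N p x = complex.Im (c * Q (t0 + 2 * x)).
  by move=> /pE <-; rewrite Im_trig_sum.
pose th (j : 'I_N.+1) : R := cos (j%:R * pi / N%:R).
pose X (j : 'I_N.+1) := acos (ka * th j).
have kth j : - ka <= ka * th j <= ka.
  by rewrite -{1}[ka]mulr1 -mulrN -{4}[ka]mulr1 !ler_pM2l// cos_geN1 cos_le1.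
have kth1 j : -1 <= ka * th j <= 1 by have := kth j; lra.
have X0 j : 0 < X j < pi.
  by rewrite acos_gt0 ?acos_ltpi//; have := kth j; lra.
have cosX j : cos (X j) = ka * th j by rewrite acosK// in_itv/=.
have XI j : s / 4 <= X j <= pi - s / 4.
  have x0 := X0 j.
  rewrite -norm_cos_le; [|lra|lra]; by rewrite cosX ler_norml; exact: kth.
have Xlt (i j : 'I_N.+1) : (i < j)%N -> X i < X j.
  move=> ij; have tt : th j < th i.
    by apply: cos_node_lt; rewrite ij /= -ltnS ltn_ord.
  rewrite ltr_acos//.
  - by have := kth1 j; lra.
  - by rewrite ltr_pM2l.
  - by have := kth1 i; lra.
have uI : injective (fun j => cot (X j)).
  move=> i j uij; apply/val_inj.
  have /andP[xi0 xip] := X0 i; have /andP[xj0 xjp] := X0 j.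
  case: (ltngtP i j) => // /Xlt lt.
    by have := cot_lt xi0 lt xjp; rewrite uij ltxx.
  by have := cot_lt xj0 lt xip; rewrite uij ltxx.
have p0 : p = 0.
  apply: (poly_eq_at uI); rewrite ?size_poly0// => j; rewrite horner0.
  have := QI _ (XI j).
  rewrite normcE (ReE _ (X0 j)) cosX mulrAC divff ?gt_eqF// mul1r /th cheb_cos.
  rewrite (_ : N%:R * _ = j%:R * pi); last by field; rewrite pnatr_eq0 -lt0n.
  rewrite cos_natpi sqrr_sign -(pE _ (X0 j)) form_cot//.
  (* The squared modulus is [1 + y ^ 2] at a node and at most 1, so the imaginary part [y]
     vanishes. *)
  set y := _ * p.[_] => hy.
  have : y ^+ 2 <= 0.
    rewrite -(lerD2l 1) addr0 -ler_sqrt ?sqrtr1//.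
  rewrite real_exprn_even_le0 ?num_real//= /y mulf_eq0 expf_eq0 => /orP[/andP[_]|/eqP//].
  by rewrite gt_eqF// sin_gt0_pi.
exists c => // t.
(* A period changes the sign of [cos (u / 2)], to which [cheb N] is insensitive because [N] is
   even. *)
have gT (u : R) : ((cheb N).[cos ((u + 2 * pi) / 2) / ka])%:C = ((cheb N).[cos (u / 2) / ka])%:C.
  rewrite (_ : (u + 2 * pi) / 2 = u / 2 + pi); last by field.
  by rewrite cosDpi mulNr -cheb2_norm normrN cheb2_norm.
have hT (u : R) : c * Q (u + 2 * pi + t0) = c * Q (u + t0).
  by rewrite addrAC QT.
have [t' t'0 tE] := period_repr (t - t0).
have := tE _ (fun u => c * Q (u + t0)) hT; rewrite subrK => ->.
rewrite (tE _ (fun u => ((cheb N).[cos (u / 2) / ka])%:C) gT).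
(* The identities for forms hold inside []0, pi[] only; at [t0] itself the assumed equality gives
   the value. *)
have [->|t'N] := eqVneq t' 0.
  by rewrite add0r cQ0 mul0r cos0 mul1r ME.
have x0 : 0 < t' / 2 < pi by have : 0 < t'; [rewrite lt_neqAle eq_sym t'N; lra|lra].
have tE2 : t' + t0 = t0 + 2 * (t' / 2) by field.
apply/eqP; rewrite eq_complex tE2 ReE//= eqxx /= -pE// p0.
by rewrite form_cot ?size_poly0// horner0 mulr0.
Qed.

End core.

(** * The theorem *)

Section main.
Context {R : realType}.
Implicit Types (n : nat) (x t : R).
Local Notation normc := ComplexField.Normc.normc.

Lemma trig_sum_max n (a b : nat -> R[i]) : exists2 t0 : R, 0 <= t0 < 2 * pi &
  forall t, normc (trig_sum n a b t) <= normc (trig_sum n a b t0).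
Proof.
have pi0 := pi_gt0 R; set Q := trig_sum n a b.
have QT t : normc (Q (t + 2 * pi)) = normc (Q t) by rewrite /Q trig_sum_periodic.
have [||c _ cmax] := @EVT_max R (fun t => normc (Q t)) 0 (2 * pi); first lra.
  by apply: continuous_subspaceT; exact: normc_trig_sum_continuous.
have [t0 t00 cE] := period_repr c.
exists t0 => // t; have [t' t'0 tE] := period_repr t.
rewrite (tE _ (fun t => normc (Q t)) QT) -(cE _ (fun t => normc (Q t)) QT).
by apply: cmax; rewrite in_itv/=; lra.
Qed.

Lemma extremal_sublevel n (s : R) (Q : R -> R[i]) : (0 < n)%N -> 0 < s < 2 * pi ->
  (forall t, Q t = ((cheb (2 * n)).[cos (t / 2) / cos (s / 4)])%:C) ->
  sublevel Q = `[s / 2, 2 * pi - s / 2]%classic.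
Proof.
move=> n0 s0 QE; have pi0 := pi_gt0 R.
have ka0 : 0 < cos (s / 4) by apply: cos_gt0_pihalf; lra.
have E t : 0 <= t < 2 * pi ->
    (normc (Q t) <= 1) = (s / 4 <= t / 2 <= pi - s / 4).
  move=> t0; rewrite QE normc_real cheb2_le1// normrM.
  rewrite [X in _ * X]gtr0_norm ?invr_gt0// ler_pdivrMr// mul1r.
  by rewrite norm_cos_le//; lra.
apply/seteqP; split => t; rewrite /= in_itv/=.
  by move=> [t0]; rewrite E//; lra.
by move=> tI; have t0 : 0 <= t < 2 * pi by [lra]; split => //; rewrite E//; lra.
Qed.

Lemma sin_eq0_period t : 0 <= t < 2 * pi -> sin t = 0 -> t = 0 \/ t = pi.
Proof.
move=> t0 st; have pi0 := pi_gt0 R.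
have [->|tN0] := eqVneq t 0; first by left.
have {}tN0 : 0 < t by rewrite lt_neqAle eq_sym tN0; lra.
have [tpi|pit|->] := ltgtP t pi; [| |by right].
  by have := @sin_gt0_pi R t; rewrite st ltxx tN0 tpi => /(_ isT).
have : 0 < sin (t - pi) by apply: sin_gt0_pi; lra.
by rewrite sinB cospi sinpi st mul0r mulr0 subrr ltxx.
Qed.

(** A function with real values equals its real part, whose coefficients are real. *)
Lemma trig_polyR_extremal n (c : R[i]) (d : R) (a b : nat -> R[i]) (f : R -> R) :
  (forall t, c * trig_sum n a b (t + d) = (f t)%:C) ->
  trig_polyR n (fun t => c * trig_sum n a b (t + d)).
Proof.
move=> fE; have [a' [b' E]] := rtrigDr n (fun k => complex.Re (c * a k))
  (fun k => complex.Re (c * b k)) d.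
exists a', b' => t; rewrite trig_sum_real -E -Re_trig_sum.
by rewrite fE.
Qed.

End main.

(* The bound and the hypotheses are invariant under Q |-> c Q (|c| = 1) and
   Q |-> Q (. + pi), so the extremal polynomial is unique only up to these. *)
Theorem theorem2p1 (R : realType) (n : nat) (s : R) (T : {poly R})
    (hn : (0 < n)%N) (hs : 0 < s < 2 * pi) (hT : is_chebyshev (2 * n) T) :
  T.[sec (s / 4)] = 1 / 2 * ((sec (s / 4) + tan (s / 4)) ^+ (2 * n) +
                             (sec (s / 4) - tan (s / 4)) ^+ (2 * n)) /\
  forall Q : R -> R[i], trig_polyC_s n s Q -> even_fun_C Q ->
    exists M : R, [/\ is_max_norm Q M,
      M <= T.[sec (s / 4)] &
      (M = T.[sec (s / 4)] <->
       exists (c : R[i]) (d : R),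
         [/\ ComplexField.Normc.normc c = 1, (d = 0 \/ d = pi) &
             let Q1 := fun t : R => c * Q (t + d) in
             [/\ sublevel Q1 = `[s / 2, 2 * pi - s / 2]%classic,
                 trig_polyR_s n s Q1 &
                 forall t : R, Q1 t = (T.[cos (t / 2) / cos (s / 4)])%:C]])].
Proof.
have pi0 := pi_gt0 R.
have N0 : (0 < 2 * n)%N by rewrite muln_gt0.
rewrite (is_chebyshevE N0 hT).
set ka := cos (s / 4).
have ka0 : 0 < ka by apply: cos_gt0_pihalf; lra.
have ka1 : ka < 1 by rewrite -[ltRHS]cos0 ltr_cos ?in_itv/=; lra.
have secE : sec (s / 4) = ka^-1 by [].
have ki1 : 1 < ka^-1 by rewrite invf_gt1.
have C1 := cheb_gt1 N0 ki1.
split.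
  (* The two bases have half-sum [sec] and product [sec ^ 2 - tan ^ 2 = 1]. *)
  rewrite mul1r [RHS]mulrC -cheb_joukowski.
    by congr (_.[_]); field.
  rewrite [LHS]mulrC -subr_sqr secE /tan -/ka exprVn expr_div_n.
  rewrite sin2cos2 -/ka.
  by field; rewrite gt_eqF.
move=> Q [[a [b QE]] mQ] Qeven.
have {QE} QE : Q = trig_sum n a b by apply/funext.
subst Q; set Q := trig_sum n a b in mQ Qeven *.
have [t0 t00 Qmax] := trig_sum_max n a b.
exists (ComplexField.Normc.normc (Q t0)); rewrite secE.
have bound : ComplexField.Normc.normc (Q t0) <= (cheb (2 * n)).[ka^-1].
  have [M1|M1] := leP (ComplexField.Normc.normc (Q t0)) 1.
    by rewrite (le_trans M1)// ltW.
  by have [] := remez_trig hn hs t00 M1 mQ.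
split => //; first by split; [exists t0|].
split=> [ME|[c [d [c1 _ [_ _ Q1E]]]]]; last first.
  (* Conversely, the given formula at 0 shows that [Q] reaches the bound at [d]. *)
  apply/eqP; rewrite eq_le bound /=.
  apply: le_trans (Qmax d).
  have := Q1E 0; rewrite mul0r cos0 mul1r add0r => /(congr1 (@ComplexField.Normc.normc R)).
  rewrite ComplexField.Normc.normcM c1 mul1r normc_real -/Q => ->.
  exact: ler_norm.
have M1 : 1 < ComplexField.Normc.normc (Q t0) by rewrite ME.
have [_ /(_ ME)[c c1 cQ]] := remez_trig hn hs t00 M1 mQ.
(* By evenness the bound is also reached at [- t0], where the formula gives the argument
   [cos t0 / ka]; hence [|cos t0| = 1]. *)
have t0E : t0 = 0 \/ t0 = pi.
  apply: sin_eq0_period t00 _; apply: cos1sin0.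
  have := cQ (- t0); rewrite -/Q Qeven cQ => /complexI.
  rewrite subrr mul0r cos0 mul1r -/ka.
  rewrite (_ : (- t0 - t0) / 2 = - t0); last by field.
  rewrite cosN => /esym e.
  have kpos : 0 <= ka^-1 by rewrite invr_ge0 ltW.
  have : `|cos t0 / ka| = ka^-1.
    apply: (@cheb2_inj_at R n) => //; first exact: ltW.
    by rewrite normrM (ger0_norm kpos) ler_piMl// cos_max.
  rewrite normrM (ger0_norm kpos) => /(congr1 (fun z => z * ka)).
  by rewrite divfK ?mulVf ?gt_eqF.
have Q1E t : c * Q (t + t0) = ((cheb (2 * n)).[cos (t / 2) / ka])%:C.
  by rewrite cQ addrK.
have subE : sublevel (fun t => c * Q (t + t0)) = `[s / 2, 2 * pi - s / 2]%classic.
  exact: extremal_sublevel hn hs Q1E.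
exists c, t0; split => //; split => //; split.
  exact: trig_polyR_extremal Q1E.
rewrite subE lebesgue_measure_itv/= lte_fin.
by case: ltP => h; rewrite -?EFinB lee_fin; lra.
Qed.
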